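(* \textsc{Min-Sum Diameter Decomposition} can be solved in $O(|V(T)|L^4)$ time, where $L=\sum_{e\in E(T)}\ell(e)$.
   Context: \textsc{Min-Sum Diameter Decomposition}: the input is a tree $T$, an edge subset $E_0\subseteq E(T)$, and a length function $\ell:E(T)\to\mathbb{Z}_{\ge0}$. The task is to find an edge set $F\subseteq E_0$ minimizing $\sum_{T'}\mathrm{diam}_\ell(T')$, where the sum ranges over all connected components $T'$ of $T-F$ and $\mathrm{diam}_\ell(T')=\max\{\ell(u,v): u,v\in V(T')\}$, with $\ell(u,v)$ the sum of lengths of the edges on the unique $u$–$v$ path in $T$.
   Formalization: The bound is stated as O(|V(T)| max(1,L)^4): for L = 0 the literal bound O(|V(T)| L^4) would be zero steps, which no algorithm meets; for L ≥ 1 the two bounds coincide. *)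

(* Defs.v *)
From mathcomp Require Import all_boot.

Set Implicit Arguments.
Unset Strict Implicit.
Unset Printing Implicit Defensive.

(* A graph on the vertices 0, ..., nV - 1 given by an edge list, together with
   the edge lengths and the set E_0 of the edges that may be removed. *)
Record instance := Instance {
  nV : nat;
  nE : nat;
  ends : 'I_nE -> 'I_nV * 'I_nV;
  len : 'I_nE -> nat;
  E0 : {set 'I_nE}
}.

Section Graph.
Variable I : instance.
Implicit Types (e f : 'I_(nE I)) (x y u v : 'I_(nV I)).
Implicit Types (F : {set 'I_(nE I)}) (C : {set 'I_(nV I)}).

Definition joins e x y := (ends e == (x, y)) || (ends e == (y, x)).

(* Adjacency in T - F. *)
Definition adj F : rel 'I_(nV I) :=
  [rel x y | [exists e, (e \notin F) && joins e x y]].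

Definition simple_graph :=
  (forall e, (ends e).1 != (ends e).2) /\
  (forall e f x y, joins e x y -> joins f x y -> e = f).

Definition connected_graph :=
  0 < nV I /\ forall x y, connect (adj set0) x y.

Definition acyclic_graph :=
  forall p : seq 'I_(nV I), 2 < size p -> ~ ucycle (adj set0) p.

Definition is_tree := [/\ simple_graph, connected_graph & acyclic_graph].

(* Paths follow the convention of path.v: the path u :: p starts at u. *)
Definition simple_path u v (p : seq 'I_(nV I)) :=
  [&& path (adj set0) u p, last u p == v & uniq (u :: p)].

(* A simple path has at most nV vertices, so the bound on the size of p is
   harmless; in a tree p is the unique simple path from u to v. *)
Definition tree_path u v : seq 'I_(nV I) :=
  if [pick p : (nV I).-bseq 'I_(nV I) | simple_path u v p] is Some p
  then p else [::].

(* In a simple graph the sum has at most one term. *)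
Definition edge_length x y := \sum_(e | joins e x y) len e.

Fixpoint path_length u (p : seq 'I_(nV I)) :=
  if p is v :: q then edge_length u v + path_length v q else 0.

Definition dist u v := path_length u (tree_path u v).

Definition components F : {set {set 'I_(nV I)}} :=
  equivalence_partition (connect (adj F)) [set: 'I_(nV I)].

Definition diam C := \max_(u in C) \max_(v in C) dist u v.

Definition cost F := \sum_(C in components F) diam C.

Definition optimal F :=
  F \subset E0 I /\ forall F', F' \subset E0 I -> cost F <= cost F'.

Definition total_length := \sum_e @len I e.

End Graph.

(* The model of computation is a word RAM, presented as a structured language
   with scalar variables and arrays, all named by numerals occurring in the
   program text (so a program uses finitely many of them).  Cells hold natural
   numbers; every operation has unit cost, and an execution is stuck as soon as
   some computed value exceeds the largest word W. *)
Inductive op := Add | Sub | Mul | Leq | Eqn.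

Inductive expr :=
  | Const of nat
  | Var of nat
  | Get of nat & expr
  | Bin of op & expr & expr.

Inductive com :=
  | Skip
  | Assign of nat & expr
  | Store of nat & expr & expr
  | Seq of com & com
  | If of expr & com & com
  | While of expr & com.

Record state := State { var : nat -> nat; arr : nat -> nat -> nat }.

Definition set_var (s : state) x v :=
  State (fun y => if y == x then v else var s y) (arr s).

Definition set_arr (s : state) a i v :=
  State (var s)
    (fun b j => if (b == a) && (j == i) then v else arr s b j).

Definition op_val (o : op) (a b : nat) : nat :=
  match o with
  | Add => a + b
  | Sub => a - b
  | Mul => a * b
  | Leq => a <= b
  | Eqn => a == b
  end.

Fixpoint eval (s : state) (e : expr) : nat :=
  match e with
  | Const c => c
  | Var x => var s x
  | Get a i => arr s a (eval s i)
  | Bin o e1 e2 => op_val o (eval s e1) (eval s e2)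
  end.

Fixpoint fits (W : nat) (s : state) (e : expr) : bool :=
  (eval s e <= W) &&
  match e with
  | Const _ | Var _ => true
  | Get _ i => fits W s i
  | Bin _ e1 e2 => fits W s e1 && fits W s e2
  end.

Fixpoint expr_time (e : expr) : nat :=
  match e with
  | Const _ | Var _ => 1
  | Get _ i => (expr_time i).+1
  | Bin _ e1 e2 => (expr_time e1 + expr_time e2).+1
  end.

(* exec W c s t s': started in state s, the program c halts after t steps in
   state s', without overflow. *)
Inductive exec (W : nat) : com -> state -> nat -> state -> Prop :=
  | ExecSkip s : exec W Skip s 1 s
  | ExecAssign x e s :
      fits W s e ->
      exec W (Assign x e) s (expr_time e).+1 (set_var s x (eval s e))
  | ExecStore a i e s :
      fits W s i -> fits W s e ->
      exec W (Store a i e) s (expr_time i + expr_time e).+1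
           (set_arr s a (eval s i) (eval s e))
  | ExecSeq c1 c2 s1 s2 s3 t1 t2 :
      exec W c1 s1 t1 s2 -> exec W c2 s2 t2 s3 ->
      exec W (Seq c1 c2) s1 (t1 + t2) s3
  | ExecIfTrue e c1 c2 s s' t :
      fits W s e -> eval s e != 0 -> exec W c1 s t s' ->
      exec W (If e c1 c2) s (expr_time e + t).+1 s'
  | ExecIfFalse e c1 c2 s s' t :
      fits W s e -> eval s e = 0 -> exec W c2 s t s' ->
      exec W (If e c1 c2) s (expr_time e + t).+1 s'
  | ExecWhileTrue e c s1 s2 s3 t1 t2 :
      fits W s1 e -> eval s1 e != 0 ->
      exec W c s1 t1 s2 -> exec W (While e c) s2 t2 s3 ->
      exec W (While e c) s1 (expr_time e + t1 + t2).+1 s3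
  | ExecWhileFalse e c s :
      fits W s e -> eval s e = 0 ->
      exec W (While e c) s (expr_time e).+1 s.

(* Variables 0 and 1 hold the numbers of vertices and edges; arrays 0 and 1 the
   endpoints of the edges, array 2 their lengths and array 3 the indicator of
   E_0.  All other cells are 0. *)
Definition edge_cell (I : instance) (g : 'I_(nE I) -> nat) (i : nat) : nat :=
  if insub i is Some e then g e else 0.

Definition input (I : instance) : state :=
  State
    (fun x => match x with 0 => nV I | 1 => nE I | _ => 0 end)
    (fun a => match a with
              | 0 => @edge_cell I (fun e => (ends e).1)
              | 1 => @edge_cell I (fun e => (ends e).2)
              | 2 => @edge_cell I (fun e => len e)
              | 3 => @edge_cell I (fun e => e \in E0 I)
              | _ => fun _ => 0
              end).

(* The edge set F returned by a program is read off array 4. *)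
Definition output (I : instance) (s : state) : {set 'I_(nE I)} :=
  [set e : 'I_(nE I) | arr s 4 e != 0].

(* Words of k * log2 (|V(T)| + L + 2) bits. *)
Definition max_word (k : nat) (I : instance) : nat :=
  (nV I + total_length I + 2) ^ k.

(* Main.v *)
(* Leaves are eliminated one by one: a leaf u has a single remaining edge e = uv,
   and the tree collected so far at u is hung below v.  For the tree collected at
   a vertex, the component of the root in T - F matters only through its height h
   and its diameter d, both at most L, so it suffices to know for each pair (h, d)
   the least total diameter of the other components.  Hanging a tree below another
   combines any two entries of their tables, either keeping e, with
   h = max(h1, h2 + l(e)) and d = max(d1, d2, h1 + h2 + l(e)), or cutting e, which
   closes a component of diameter d2.  With (L + 1)^2 entries per table a merge
   takes O((L + 1)^4) steps and there are |V(T)| - 1 merges; an optimal set is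
   recovered through the entries each optimum comes from.  Linear time apart from
   the merges is achieved by keeping the degree and the sum of the remaining edges
   at every vertex, and by letting the elimination continue at v before the scan
   of the vertices advances. *)
Require Import Defs.
From mathcomp Require Import all_boot zify.

Set Implicit Arguments.
Unset Strict Implicit.
Unset Printing Implicit Defensive.

(** * Total correctness with running time *)

(** The elimination order becomes an inductive object: [mtree] records which tree was hung where, so
    heights, diameters and costs obey structural recursions, and the components, distances and costs
    of the graph need to be compared with them only for a spanning merge tree. Bounded tables are
    enough because, for every [F], the diameter of the root component plus the diameters of the
    closed components is at most [L]; candidates exceeding this are discarded, which also keeps the
    words small. Entries are indexed by exact heights and diameters, not by bounds for them: the
    outcome of a combination then depends on the indices alone, and edge sets with the same index
    are interchangeable up to cost. Values are shifted by one because untouched memory reads 0.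
    Recovering the set requires that selections written on behalf of different parents do not
    collide, hence the invariant that a node has a single parent. Every loop runs a number of times
    known on entry; for the elimination this is [n + m + 1], each round either removing an edge or
    advancing the scan. *)

Definition runs W c s T (Q : state -> Prop) :=
  exists t s', [/\ exec W c s t s', t <= T & Q s'].

Fixpoint wvars (c : com) : seq nat :=
  match c with
  | Assign x _ => [:: x]
  | Seq c1 c2 | If _ c1 c2 => wvars c1 ++ wvars c2
  | While _ c1 => wvars c1
  | _ => [::]
  end.

Fixpoint warrs (c : com) : seq nat :=
  match c with
  | Store a _ _ => [:: a]
  | Seq c1 c2 | If _ c1 c2 => warrs c1 ++ warrs c2
  | While _ c1 => warrs c1
  | _ => [::]
  end.

Definition agree (xs bs : seq nat) (s s' : state) :=
  (forall x, x \notin xs -> var s' x = var s x) /\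
  (forall a, a \notin bs -> arr s' a =1 arr s a).

Definition frame c := agree (wvars c) (warrs c).

Lemma agree_trans xs bs s1 s2 s3 :
  agree xs bs s1 s2 -> agree xs bs s2 s3 -> agree xs bs s1 s3.
Proof.
move=> [v12 a12] [v23 a23]; split=> [x hx|a ha i]; first by rewrite v23 ?v12.
by rewrite a23 ?a12.
Qed.

Lemma agree_sub xs bs xs' bs' s s' :
  {subset xs <= xs'} -> {subset bs <= bs'} -> agree xs bs s s' ->
  agree xs' bs' s s'.
Proof.
move=> hx hb [hv ha]; split=> [x nx|b nb]; first by apply: hv; apply: contra nx; apply: hx.
by apply: ha; apply: contra nb; apply: hb.
Qed.

(** This lets postconditions and invariants mention only the cells that change: [runs_weaken],
    [runs_seq] and [runs_for] hand over what the syntax of the command leaves untouched. *)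
Lemma exec_frame W c s t s' : exec W c s t s' -> frame c s s'.
Proof.
elim=> {c s t s'} //=.
- move=> x e s _; split=> //= y; rewrite inE => /negPf->//.
- move=> a i e s _ _; split=> //= b; rewrite inE => /negPf-> //.
- move=> c1 c2 s1 s2 s3 t1 t2 _ h1 _ h2; apply: (@agree_trans _ _ _ s2).
    by apply: agree_sub h1 => x; rewrite mem_cat => ->.
  by apply: agree_sub h2 => x; rewrite mem_cat => ->; rewrite orbT.
- move=> e c1 c2 s s' t _ _ _ h.
  by apply: agree_sub h => x; rewrite mem_cat => ->.
- move=> e c1 c2 s s' t _ _ _ h.
  by apply: agree_sub h => x; rewrite mem_cat => ->; rewrite orbT.
- by move=> e c s1 s2 s3 t1 t2 _ _ _ h1 _ h2; apply: agree_trans h1 h2.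
Qed.

Lemma runs_weaken W c s T T' (Q Q' : state -> Prop) :
  T <= T' -> (forall s', frame c s s' -> Q s' -> Q' s') ->
  runs W c s T Q -> runs W c s T' Q'.
Proof.
move=> hT hQ [t [s' [he ht h]]]; exists t, s'; split=> //; first exact: leq_trans hT.
by apply: hQ h; apply: exec_frame he.
Qed.

Lemma runs_seq W c1 c2 s T1 T2 Q :
  runs W c1 s T1 (fun s1 => frame c1 s s1 -> runs W c2 s1 T2 Q) ->
  runs W (Seq c1 c2) s (T1 + T2) Q.
Proof.
move=> [t1 [s1 [he1 ht1 h]]]; have [t2 [s2 [he2 ht2 hQ]]] := h (exec_frame he1).
by exists (t1 + t2), s2; split; [apply: ExecSeq he1 he2 | apply: leq_add |].
Qed.

Lemma runs_if W e c1 c2 s T Q :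
  fits W s e ->
  (eval s e != 0 -> runs W c1 s T Q) -> (eval s e = 0 -> runs W c2 s T Q) ->
  runs W (If e c1 c2) s (expr_time e + T).+1 Q.
Proof.
move=> hf h1 h2; have [E|N] := eqVneq (eval s e) 0.
  have [t [s' [he ht hQ]]] := h2 E; exists (expr_time e + t).+1, s'.
  by split=> //; [apply: ExecIfFalse | rewrite ltnS leq_add2l].
have [t [s' [he ht hQ]]] := h1 N; exists (expr_time e + t).+1, s'.
by split=> //; [apply: ExecIfTrue | rewrite ltnS leq_add2l].
Qed.

(* [wp] is [False] on loops: only [runs_for] reasons about them. *)
Fixpoint wp W c (Q : state -> Prop) s : Prop :=
  match c with
  | Skip => Q s
  | Assign x e => fits W s e /\ Q (set_var s x (eval s e))
  | Store a i e =>
      (fits W s i && fits W s e) /\ Q (set_arr s a (eval s i) (eval s e))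
  | Seq c1 c2 => wp W c1 (wp W c2 Q) s
  | If e c1 c2 =>
      [/\ fits W s e, eval s e != 0 -> wp W c1 Q s
        & eval s e = 0 -> wp W c2 Q s]
  | While _ _ => False
  end.

(** An upper bound: a conditional is charged for both branches. The value at a loop is arbitrary, as
    [wp] is [False] there. *)
Fixpoint ctime c : nat :=
  match c with
  | Skip => 1
  | Assign _ e => (expr_time e).+1
  | Store _ i e => (expr_time i + expr_time e).+1
  | Seq c1 c2 => ctime c1 + ctime c2
  | If e c1 c2 => (expr_time e + (ctime c1 + ctime c2)).+1
  | While _ _ => 0
  end.

Lemma runs_wp W c s Q : wp W c Q s -> runs W c s (ctime c) Q.
Proof.
elim: c s Q => /= [|x e|a i e|c1 h1 c2 h2|e c1 h1 c2 h2|//] s Q.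
- by move=> hQ; exists 1, s; split=> //; apply: ExecSkip.
- by move=> [hf hQ]; eexists _, _; split; [apply: ExecAssign | |].
- by move=> [/andP[hi hf] hQ]; eexists _, _; split; [apply: ExecStore | |].
- move=> /h1 h; apply: runs_seq; apply: runs_weaken h => // s' _ hw _.
  exact: h2.
- move=> [hf hT hF]; apply: runs_if => // hE.
    by apply: runs_weaken (h1 _ _ (hT hE)) => //; apply: leq_addr.
  by apply: runs_weaken (h2 _ _ (hF hE)) => //; apply: leq_addl.
Qed.

Lemma wp_conseq W c s (Q Q' : state -> Prop) :
  (forall s', Q s' -> Q' s') -> wp W c Q s -> wp W c Q' s.
Proof.
elim: c s Q Q' => /= [|x e|a i e|c1 h1 c2 h2|e c1 h1 c2 h2|//] s Q Q' hQ.
- exact: hQ.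
- by move=> [hf h]; split=> //; apply: hQ.
- by move=> [hf h]; split=> //; apply: hQ.
- by apply: h1 => s'; apply: h2.
- by move=> [hf hT hF]; split=> // hE; [apply: (h1 _ Q) => //; apply: hT
    | apply: (h2 _ Q) => //; apply: hF].
Qed.

Lemma wp_seq W c1 c2 s (Q1 Q : state -> Prop) :
  wp W c1 Q1 s -> (forall s1, Q1 s1 -> wp W c2 Q s1) -> wp W (Seq c1 c2) Q s.
Proof. by move=> h1 h2; apply: wp_conseq h1. Qed.

Definition For x b c :=
  Seq (Assign x (Const 0))
      (While (Bin Leq (Bin Add (Var x) (Const 1)) (Var b))
             (Seq c (Assign x (Bin Add (Var x) (Const 1))))).

(** Besides its body, a round costs 6 steps for the test and 4 for the increment; the final 10 cover
    the initial assignment and the failing test. *)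
Definition for_time N T := N * (T + 10) + 10.

(** The side condition keeps the counter and its bound out of reach of the body, so there are
    exactly [N] rounds. The last test computes [N + 1], whence [N < W]. *)
Lemma runs_for W x b c s T N (Inv : nat -> state -> Prop) :
  [&& x != b, x \notin wvars c & b \notin wvars c] ->
  var s b = N -> N < W -> Inv 0 (set_var s x 0) ->
  (forall i s1, i < N -> var s1 x = i -> agree (x :: wvars c) (warrs c) s s1 ->
     Inv i s1 -> runs W c s1 T (fun s2 => Inv i.+1 (set_var s2 x i.+1))) ->
  runs W (For x b c) s (for_time N T) (Inv N).
Proof.
move=> /and3P[xb xc bc] hN hW h0 hI.
have ag0 : agree (x :: wvars c) (warrs c) s (set_var s x 0).
  by split=> //= y; rewrite inE negb_or => /andP[/negPf->].
suff : forall k i s1, i + k = N -> var s1 x = i ->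
    agree (x :: wvars c) (warrs c) s s1 -> Inv i s1 ->
    runs W (While (Bin Leq (Bin Add (Var x) (Const 1)) (Var b))
             (Seq c (Assign x (Bin Add (Var x) (Const 1))))) s1
      (k * (T + 10) + 8) (Inv N).
  move=> /(_ N 0 (set_var s x 0)) []//=; first by rewrite eqxx.
  move=> t [s' [he ht hQ]]; exists (2 + t), s'; split=> //.
    apply: ExecSeq he; apply: (@ExecAssign W x (Const 0) s).
    by [].
  by rewrite /for_time; lia.
elim=> [|k IH] i s1 hik hx ag hi.
  have E : eval s1 (Bin Leq (Bin Add (Var x) (Const 1)) (Var b)) = 0.
    rewrite /= hx (ag.1 b) ?hN; first by rewrite -hik addn0 addn1 ltnn.
    by rewrite inE negb_or bc eq_sym xb.
  exists 6, s1; split=> //; last by rewrite -hik addn0.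
  apply: ExecWhileFalse E => /=.
  rewrite hx (ag.1 b) ?hN; last by rewrite inE negb_or bc eq_sym xb.
  by lia.
have bE s2 : agree (x :: wvars c) (warrs c) s s2 -> var s2 b = N.
  by move=> a2; rewrite (a2.1 b) ?hN // inE negb_or bc eq_sym xb.
have E : eval s1 (Bin Leq (Bin Add (Var x) (Const 1)) (Var b)) != 0.
  by rewrite /= hx (bE _ ag); lia.
have iN : i < N by lia.
have [t2 [s2 [he2 ht2 hi2]]] := hI i s1 iN hx ag hi.
have fr := exec_frame he2.
have x2 : var s2 x = i by rewrite (fr.1 x).
have ag2 : agree (x :: wvars c) (warrs c) s (set_var s2 x i.+1).
  split=> [y|a ha j] /=.
    rewrite inE negb_or => /andP[/negPf yx yc]; rewrite yx (fr.1 y) // (ag.1 y) //.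
    by rewrite inE yx.
  by rewrite (fr.2 a) // (ag.2 a).
have x3 : var (set_var s2 x i.+1) x = i.+1 by rewrite /= eqxx.
have ik : i.+1 + k = N by lia.
have [t3 [s3 [he3 ht3 hi3]]] := IH i.+1 _ ik x3 ag2 hi2.
exists (5 + (t2 + 4) + t3).+1, s3; split=> //; last by lia.
apply: (ExecWhileTrue _ E) he3.
  by rewrite /= hx (bE _ ag); lia.
apply: ExecSeq he2 _.
have -> : i.+1 = eval s2 (Bin Add (Var x) (Const 1)) by rewrite /= x2 addn1.
apply: ExecAssign; rewrite /= x2; lia.
Qed.

(** * Merge trees *)

Lemma joins_sym (I : instance) (e : 'I_(nE I)) x y : joins e x y = joins e y x.
Proof. by rewrite /joins orbC. Qed.

Section MergeTree.
Variable I : instance.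
Local Notation V := 'I_(nV I).
Local Notation E := 'I_(nE I).

(* [Node e t1 t2] hangs the rooted tree [t2] below the root of [t1] by the
   edge [e]; its root is the root of [t1]. *)
Inductive mtree := Leaf of V | Node of E & mtree & mtree.

Fixpoint troot t : V :=
  match t with Leaf v => v | Node _ t1 _ => troot t1 end.

Fixpoint verts t : seq V :=
  match t with Leaf v => [:: v] | Node _ t1 t2 => verts t1 ++ verts t2 end.

Fixpoint edges t : seq E :=
  match t with Leaf _ => [::] | Node e t1 t2 => e :: edges t1 ++ edges t2 end.

Fixpoint wf t : Prop :=
  match t with
  | Leaf _ => True
  | Node e t1 t2 =>
      [/\ joins e (troot t1) (troot t2), ~~ has (mem (verts t1)) (verts t2),
          wf t1 & wf t2]
  end.

Lemma troot_verts t : troot t \in verts t.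
Proof. by elim: t => [v|e t1 h1 t2 _] /=; rewrite ?inE ?eqxx // mem_cat h1. Qed.

Lemma size_verts t : size (verts t) = (size (edges t)).+1.
Proof. by elim: t => //= e t1 h1 t2 h2; rewrite !size_cat h1 h2 addnS. Qed.

Lemma verts_uniq t : wf t -> uniq (verts t).
Proof.
elim: t => //= e t1 h1 t2 h2 [_ hd w1 w2].
by rewrite cat_uniq h1 // h2 // hd.
Qed.

Lemma joins_inj (e : E) (x y a b : V) : joins e x y -> joins e a b ->
  (a = x /\ b = y) \/ (a = y /\ b = x).
Proof.
by rewrite /joins => /orP[]/eqP-> /orP[]/eqP[-> ->]; [left|right|right|left].
Qed.

Lemma edges_verts t f x y :
  wf t -> f \in edges t -> joins f x y -> (x \in verts t) && (y \in verts t).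
Proof.
elim: t => //= e t1 h1 t2 h2 [je _ w1 w2]; rewrite !mem_cat inE mem_cat.
case/or3P => [/eqP->|f1|f2] jf.
- by case: (joins_inj je jf) => -[-> ->]; rewrite !troot_verts !orbT.
- by case/andP: (h1 w1 f1 jf) => -> ->.
- by case/andP: (h2 w2 f2 jf) => -> ->; rewrite !orbT.
Qed.

Lemma verts_disj e t1 t2 x :
  wf (Node e t1 t2) -> x \in verts t1 -> x \in verts t2 -> False.
Proof. by case=> _ /hasPn hd _ _ x1 /hd /=; rewrite x1. Qed.

(** The component of the root in [t - F]; [ocomps] collects the components closed by a cut. That
    they are the connected components follows from [comps_closed] and [comps_connect]. *)
Fixpoint rcomp (F : {set E}) t : seq V :=
  match t with
  | Leaf v => [:: v]
  | Node e t1 t2 => rcomp F t1 ++ (if e \in F then [::] else rcomp F t2)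
  end.

Fixpoint ocomps (F : {set E}) t : seq (seq V) :=
  match t with
  | Leaf v => [::]
  | Node e t1 t2 =>
      ocomps F t1 ++ ocomps F t2 ++ (if e \in F then [:: rcomp F t2] else [::])
  end.

Definition comps F t := rcomp F t :: ocomps F t.

Lemma in_comps F t s :
  (s \in comps F t) = (s == rcomp F t) || (s \in ocomps F t).
Proof. exact: in_cons. Qed.

Lemma troot_rcomp F t : troot t \in rcomp F t.
Proof. by elim: t => [v|e t1 h1 t2 _] /=; rewrite ?inE ?eqxx // mem_cat h1. Qed.

Lemma perm_comps F t : perm_eq (flatten (comps F t)) (verts t).
Proof.
rewrite /comps; elim: t => //= e t1 h1 t2 h2.
apply/permP => a; move/permP/(_ a): h1; move/permP/(_ a): h2.
rewrite /= !flatten_cat !count_cat; case: (e \in F); rewrite /= ?cats0; lia.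
Qed.

Lemma comps_verts F t s x : s \in comps F t -> x \in s -> x \in verts t.
Proof.
move=> hs hx; rewrite -(perm_mem (perm_comps F t)).
by apply/flattenP; exists s.
Qed.

Lemma rcomp_verts F t x : x \in rcomp F t -> x \in verts t.
Proof. by apply: comps_verts; apply: mem_head. Qed.

Lemma comps_Node F e t1 t2 s : s \in comps F (Node e t1 t2) ->
  [\/ s \in ocomps F t1, s \in ocomps F t2,
      e \in F /\ (s = rcomp F t1 \/ s = rcomp F t2)
    | e \notin F /\ s = rcomp F t1 ++ rcomp F t2].
Proof.
rewrite /comps /= inE !mem_cat; case: (boolP (e \in F)) => he /=.
  rewrite cats0 inE => /or4P[/eqP->|h|h|/eqP->].
  - by constructor 3; split=> //; left.
  - by constructor 1.
  - by constructor 2.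
  - by constructor 3; split=> //; right.
rewrite in_nil orbF => /or3P[/eqP->|h|h]; [constructor 4|constructor 1|constructor 2] => //.
Qed.

(** An edge of one part cannot leave that part, and the edge [e] of the node only joins the two
    roots, which lie in the root components. *)
Lemma comps_closed F t s f x y : wf t -> s \in comps F t -> f \in edges t ->
  f \notin F -> joins f x y -> x \in s -> y \in s.
Proof.
elim: t s => //= e t1 h1 t2 h2 s wt hs hf nf jf xs.
have [je hd w1 w2] := wt.
have sub1 s' : s' \in ocomps F t1 -> s' \in comps F t1 by rewrite in_comps orbC => ->.
have sub2 s' : s' \in ocomps F t2 -> s' \in comps F t2 by rewrite in_comps orbC => ->.
have sr1 : rcomp F t1 \in comps F t1 by apply: mem_head.
have sr2 : rcomp F t2 \in comps F t2 by apply: mem_head.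
have in1 s' : s' \in comps F t1 -> x \in s' -> f \in e :: edges t1 ++ edges t2 ->
    f = e \/ y \in s'.
  move=> hs' xs'; rewrite inE mem_cat => /or3P[/eqP->|f1|f2]; first by left.
    by right; apply: h1 xs'.
  have /andP[x2 _] := edges_verts w2 f2 jf.
  by case: (verts_disj wt (comps_verts hs' xs') x2).
have in2 s' : s' \in comps F t2 -> x \in s' -> f \in e :: edges t1 ++ edges t2 ->
    f = e \/ y \in s'.
  move=> hs' xs'; rewrite inE mem_cat => /or3P[/eqP->|f1|f2]; first by left.
    have /andP[x1 _] := edges_verts w1 f1 jf.
    by case: (verts_disj wt x1 (comps_verts hs' xs')).
  by right; apply: h2 xs'.
(* The concatenated components have no repetition, so a closed component does not contain the
   root. *)
have uni t s' : wf t -> s' \in ocomps F t -> troot t \in s' -> False.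
  move=> wt' hs' hr; have := verts_uniq wt'; rewrite -(perm_uniq (perm_comps F t)).
  rewrite /comps /= cat_uniq => /and3P[_ /hasPn/(_ (troot t)) h _].
  by move: h; rewrite /= troot_rcomp => h; have: false by apply: h; apply/flattenP; exists s'.
have eE : f = e -> (x = troot t1 /\ y = troot t2) \/ (x = troot t2 /\ y = troot t1).
  by move=> fe; rewrite fe in jf; apply: joins_inj je jf.
case: (comps_Node hs) => [hs1|hs2|[eF [] es]|[neF es]].
- case: (in1 s (sub1 _ hs1) xs hf) => // /eE[] [ex ey].
    by rewrite ex in xs; case: (uni _ _ w1 hs1 xs).
  have x1 := comps_verts (sub1 _ hs1) xs.
  by case: (verts_disj wt x1); rewrite ex troot_verts.
- case: (in2 s (sub2 _ hs2) xs hf) => // /eE[] [ex ey]; last first.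
    by rewrite ex in xs; case: (uni _ _ w2 hs2 xs).
  have x2 := comps_verts (sub2 _ hs2) xs.
  by case: (verts_disj wt _ x2); rewrite ex troot_verts.
- rewrite {}es in xs hs *; case: (in1 _ sr1 xs hf) => // fe.
  by rewrite fe eF in nf.
- rewrite {}es in xs hs *; case: (in2 _ sr2 xs hf) => // fe.
  by rewrite fe eF in nf.
- rewrite {}es in xs hs *; move: xs; rewrite !mem_cat => xs.
  case/orP: xs => xs.
    case: (in1 _ sr1 xs hf) => [/eE[] [ex ey]|->//].
      by rewrite ey troot_rcomp orbT.
    by rewrite ey troot_rcomp.
  case: (in2 _ sr2 xs hf) => [/eE[] [ex ey]|->]; last by rewrite orbT.
    by rewrite ey troot_rcomp orbT.
  by rewrite ey troot_rcomp.
Qed.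

Lemma adj_connect (F : {set E}) f x y :
  f \notin F -> joins f x y -> connect (adj F) x y.
Proof. by move=> nf jf; apply: connect1; apply/existsP; exists f; rewrite nf. Qed.

Lemma adj_sym (F : {set E}) : symmetric (adj F).
Proof. by move=> x y; apply: eq_existsb => e; rewrite joins_sym. Qed.

Lemma connect_adj_sym (F : {set E}) : connect_sym (adj F).
Proof. exact: sym_connect_sym (adj_sym F). Qed.

Lemma rcomp_connect F t x : wf t -> x \in rcomp F t -> connect (adj F) (troot t) x.
Proof.
elim: t x => /= [v|e t1 h1 t2 h2] x; first by rewrite inE => _ /eqP->.
move=> [je _ w1 w2]; rewrite mem_cat => /orP[/h1->//|].
case: (boolP (e \in F)) => // ne /h2 h.
by apply: connect_trans (h w2); apply: adj_connect je.
Qed.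

Lemma comps_connect F t s x y : wf t -> s \in comps F t -> x \in s -> y \in s ->
  connect (adj F) x y.
Proof.
have rc t' : wf t' -> x \in rcomp F t' -> y \in rcomp F t' -> connect (adj F) x y.
  move=> w hx hy; apply: connect_trans (rcomp_connect w hy).
  by rewrite connect_adj_sym rcomp_connect.
move=> wt; rewrite in_comps => /orP[/eqP->|]; first exact: rc.
elim: t wt => //= e t1 h1 t2 h2 [_ _ w1 w2]; rewrite !mem_cat.
case/or3P => [h|h|]; [exact: h1|exact: h2|].
by case: (e \in F); rewrite ?in_nil // inE => /eqP->; apply: rc.
Qed.


Definition seq_diam (dst : V -> V -> nat) (s : seq V) :=
  \max_(x <- s) \max_(y <- s) dst x y.

(** For a spanning merge tree the class of a vertex is the member of [comps F t] containing it:
    [comps_closed] confines a walk to that member, [comps_connect] reaches all of it. *)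
Lemma cost_comps F t : wf t -> (forall x, x \in verts t) ->
  (forall e, e \in edges t) ->
  cost F = \sum_(s <- comps F t) seq_diam (@dist I) s.
Proof.
move=> wt hV hE.
have sameP s x : s \in comps F t -> x \in s ->
    [set y in setT | connect (adj F) x y] = [set y in s].
  move=> hs xs; apply/setP => y; rewrite !inE /=; apply/idP/idP; last first.
    exact: comps_connect wt hs xs.
  case/connectP => p hp ->; elim: p x xs hp => //= z p IH x xs /andP[az hp].
  apply: IH hp; case/existsP: az => f /andP[nf jf].
  exact: (comps_closed wt hs (hE f) nf jf xs).
have ne s : s \in comps F t -> exists x, x \in s.
  rewrite in_comps => /orP[/eqP->|]; first by exists (troot t); apply: troot_rcomp.
  elim: (t) => //= e t1 h1 t2 h2; rewrite !mem_cat => /or3P[/h1//|/h2//|].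
  case: (e \in F); rewrite ?in_nil // inE => /eqP->.
  by exists (troot t2); apply: troot_rcomp.
have eqC : components F = [set C in [seq [set y in s] | s <- comps F t]].
  apply/setP => C; rewrite inE; apply/imsetP/mapP => [[x _ ->]|[s hs ->]].
    have: x \in flatten (comps F t) by rewrite (perm_mem (perm_comps F t)).
    by case/flattenP => s hs xs; exists s => //; apply: sameP.
  by have [x xs] := ne s hs; exists x => //; rewrite (sameP s).
(* The members are nonempty and disjoint, hence distinct as sets; the sum over a set of sets becomes
   a sum over the list. *)
have uniqC : uniq [seq [set y in s] | s <- comps F t].
  have : uniq (flatten (comps F t)).
    by rewrite (perm_uniq (perm_comps F t)) verts_uniq.
  elim: (comps F t) ne {eqC sameP} => //= s cs IH ne.
  rewrite cat_uniq => /and3P[us hd ucs]; rewrite IH ?andbT //; last first.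
    by move=> s' hs'; apply: ne; rewrite inE hs' orbT.
  apply/mapP => -[s' hs' /setP E]; have [x xs] := ne s (mem_head _ _).
  move/(_ x): E; rewrite !inE xs => /esym xs'.
  by case/hasP: hd; exists x => //; apply/flattenP; exists s'.
rewrite /cost eqC (eq_bigl (fun C => C \in [seq [set y in s] | s <- comps F t])); last first.
  by move=> C; rewrite inE.
rewrite -big_uniq // big_map; apply: eq_bigr => s _.
rewrite /diam /seq_diam; have bigE g : \max_(x in [set y in s]) g x = \max_(x <- s) g x.
  apply/eqP; rewrite eqn_leq; apply/andP; split.
    by apply/bigmax_leqP => x; rewrite inE => xs; apply: leq_bigmax_seq.
  by apply/bigmax_leqP_seq => x xs _; apply: leq_bigmax_cond; rewrite inE.
by rewrite bigE; apply: eq_bigr => x _; rewrite bigE.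
Qed.

End MergeTree.

(** * Paths through a bridge and distances in a merge tree *)

Section Bridge.
Variables (T : eqType) (R R1 R2 : rel T) (V1 V2 : pred T) (r1 r2 : T).
Hypothesis bridge : forall a b, R a b ->
  [\/ R1 a b, R2 a b, a = r1 /\ b = r2 | a = r2 /\ b = r1].
Hypothesis in1 : forall a b, R1 a b -> V1 a && V1 b.
Hypothesis in2 : forall a b, R2 a b -> V2 a && V2 b.
Hypothesis disj : forall a, V1 a -> V2 a -> False.
Hypothesis V2r2 : V2 r2.

(** The other side can be entered only through [r2]. *)
Lemma path_same_side x p : V1 x -> path R x p -> r2 \notin p ->
  path R1 x p /\ V1 (last x p).
Proof.
elim: p x => //= y p IH x Vx /andP[Rxy hp]; rewrite inE negb_or => /andP[ny np].
case: (bridge Rxy) => [h|h|[_ e]|[e _]].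
- by rewrite h /=; apply: IH => //; case/andP: (in1 h).
- by case/andP: (in2 h) => /(disj Vx).
- by rewrite e eqxx in ny.
- by rewrite e in Vx; case: (disj Vx).
Qed.

End Bridge.

(** A simple path uses the bridge at most once: after reaching [r2] it could return only through
    [r1], which it has already visited. *)
Lemma path_across (T : eqType) (R R1 R2 : rel T) (V1 V2 : pred T) (r1 r2 : T) x p :
  (forall a b, R a b -> [\/ R1 a b, R2 a b, a = r1 /\ b = r2 | a = r2 /\ b = r1]) ->
  (forall a b, R1 a b -> V1 a && V1 b) -> (forall a b, R2 a b -> V2 a && V2 b) ->
  (forall a, V1 a -> V2 a -> False) -> V1 r1 -> V2 r2 ->
  V1 x -> path R x p -> uniq (x :: p) ->
  (path R1 x p /\ V1 (last x p)) \/
  exists p1 p2, [/\ p = p1 ++ r2 :: p2, path R1 x p1, last x p1 = r1,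
                    path R2 r2 p2 & V2 (last r2 p2)].
Proof.
move=> br h1 h2 dj V1r V2r Vx hp up.
have [rp|nrp] := boolP (r2 \in p); last first.
  by left; apply: (path_same_side br h1 h2 dj V2r).
right; case/splitPr: rp hp up => p1 p2 hp up.
move: hp; rewrite cat_path /= => /and3P[hp1 hr hp2].
exists p1, p2; rewrite -cat_cons cat_uniq in up.
case/and3P: up => u1 hd u2; rewrite /= negb_or in hd; case/andP: hd => nr2 hd.
have nr2p : r2 \notin p1 by move: nr2; rewrite inE negb_or => /andP[].
have [pp1 Vl] := path_same_side br h1 h2 dj V2r Vx hp1 nr2p.
have el : last x p1 = r1.
  case: (br _ _ hr) => [h|h|[]//|[e _]].
  - by case/andP: (h1 _ _ h) => _ /dj; case.
  - by case/andP: (h2 _ _ h) => /(dj _ Vl).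
  - by rewrite e in Vl; case: (dj _ Vl).
have br' a b : R a b -> [\/ R2 a b, R1 a b, a = r2 /\ b = r1 | a = r1 /\ b = r2].
  by case/br; [constructor 2|constructor 1|constructor 4|constructor 3].
have dj' a : V2 a -> V1 a -> False by move=> ? ?; apply: (dj a).
have nr1 : r1 \notin p2.
  apply: contra hd => hr1; apply/hasP; exists r1 => //=.
  by rewrite -el mem_last.
by have [] := path_same_side br' h2 h1 dj' V1r V2r hp2 nr1.
Qed.

Section Distance.
Variable I : instance.
Local Notation V := 'I_(nV I).
Local Notation E := 'I_(nE I).
Implicit Types (t : mtree I) (x y : V).

(** Only membership in [t1] is tested; a vertex outside it is taken to lie in [t2]. *)
Fixpoint tdist t x y :=
  match t with
  | Leaf _ => 0
  | Node e t1 t2 =>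
      if x \in verts t1 then
        if y \in verts t1 then tdist t1 x y
        else tdist t1 x (troot t1) + len e + tdist t2 (troot t2) y
      else
        if y \in verts t1 then tdist t2 x (troot t2) + len e + tdist t1 (troot t1) y
        else tdist t2 x y
  end.

Definition tadj t : rel V := [rel x y | has (fun e => joins e x y) (edges t)].

Lemma edge_length_joins (f : E) x y :
  simple_graph I -> joins f x y -> edge_length x y = len f.
Proof.
move=> [_ h] jf; rewrite /edge_length (big_pred1 f) // => e /=.
by apply/idP/eqP => [je|->//]; apply: h je jf.
Qed.

Lemma path_length_cat x p q :
  path_length x (p ++ q) = path_length x p + path_length (last x p) q.
Proof. by elim: p x => //= y p IH x; rewrite IH addnA. Qed.

(** By [path_across] a path either stays in one part or splits at [e] into two simple paths, and
    induction applies to each. *)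
Lemma path_tdist t x p : simple_graph I -> wf t -> x \in verts t ->
  path (tadj t) x p -> uniq (x :: p) -> path_length x p = tdist t x (last x p).
Proof.
move=> sg; elim: t x p => [v|e t1 IH1 t2 IH2] x p wt xt hp up; first by case: p hp up.
have [je _ w1 w2] := wt.
have br a b : tadj (Node e t1 t2) a b ->
    [\/ tadj t1 a b, tadj t2 a b, a = troot t1 /\ b = troot t2
      | a = troot t2 /\ b = troot t1].
  move=> /hasP[f] /=; rewrite inE mem_cat => /or3P[/eqP->|hf|hf] jf.
  - by case: (joins_inj je jf) => -[-> ->]; [constructor 3|constructor 4].
  - by constructor 1; apply/hasP; exists f.
  - by constructor 2; apply/hasP; exists f.
have br' a b : tadj (Node e t1 t2) a b ->
    [\/ tadj t2 a b, tadj t1 a b, a = troot t2 /\ b = troot t1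
      | a = troot t1 /\ b = troot t2].
  by case/br; [constructor 2|constructor 1|constructor 4|constructor 3].
have in1 a b : tadj t1 a b -> (a \in verts t1) && (b \in verts t1).
  by case/hasP=> f hf jf; apply: edges_verts jf.
have in2 a b : tadj t2 a b -> (a \in verts t2) && (b \in verts t2).
  by case/hasP=> f hf jf; apply: edges_verts jf.
have dj a : a \in verts t1 -> a \in verts t2 -> False by apply: verts_disj wt.
have dj' a : a \in verts t2 -> a \in verts t1 -> False by move=> ? ?; apply: (dj a).
have n1 a : a \in verts t2 -> (a \in verts t1) = false.
  by move=> h2; apply/negP => h1; apply: dj h2.
have r1 := troot_verts t1; have r2 := troot_verts t2.
have uq (p1 p2 : seq V) r : uniq (x :: p1 ++ r :: p2) ->
    uniq (x :: p1) /\ uniq (r :: p2).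
  by rewrite -cat_cons cat_uniq => /and3P[].
move: xt; rewrite /= mem_cat => /orP[] xt.
  case: (path_across br in1 in2 dj r1 r2 xt hp up) => [[hp1 l1]|[p1 [p2]]].
    by rewrite xt l1; apply: IH1.
  case=> ep hp1 l1 hp2 l2; rewrite ep in up; have [u1 u2] := uq _ _ _ up.
  rewrite ep path_length_cat last_cat /= xt n1 // l1.
  rewrite (edge_length_joins sg je) (IH1 _ _ w1 xt hp1 u1) (IH2 _ _ w2 r2 hp2 u2) l1.
  by rewrite addnA.
case: (path_across br' in2 in1 dj' r2 r1 xt hp up) => [[hp1 l1]|[p1 [p2]]].
  by rewrite !n1 //; apply: IH2.
case=> ep hp1 l1 hp2 l2; rewrite ep in up; have [u1 u2] := uq _ _ _ up.
rewrite ep path_length_cat last_cat /= l2 n1 // l1.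
have je' : joins e (troot t2) (troot t1) by rewrite joins_sym.
rewrite (edge_length_joins sg je') (IH2 _ _ w2 xt hp1 u1) (IH1 _ _ w1 r1 hp2 u2) l1.
by rewrite addnA.
Qed.

(** All simple paths from [x] to [y] have length [tdist t x y], so the one picked by [tree_path]
    does not matter; connectivity excludes its default value. *)
Lemma dist_tdist t x y : simple_graph I -> connected_graph I -> wf t ->
  (forall x, x \in verts t) -> (forall e, e \in edges t) ->
  dist x y = tdist t x y.
Proof.
move=> sg [_ cg] wt hV hE.
rewrite /dist /tree_path; case: pickP => [p /and3P[hp /eqP hl up]|no].
  rewrite -hl; apply: path_tdist => //.
  apply: sub_path hp => a b /existsP[e /andP[_ je]]; apply/hasP; exists e => //.
have /connectP[q hq eq] := cg x y; case/shortenP: hq eq => q' hq' uq' _ eq.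
have sq : size q' <= nV I.
  apply: ltnW; move/card_uniqP: uq' => /= <-; apply: leq_trans (max_card _) _.
  by rewrite card_ord.
by have := no (Bseq sq); rewrite /simple_path hq' -eq eqxx uq'.
Qed.

Lemma tdist_sym t x y : wf t -> x \in verts t -> y \in verts t ->
  tdist t x y = tdist t y x.
Proof.
elim: t x y => //= e t1 h1 t2 h2 x y [_ _ w1 w2].
have s1 := troot_verts t1; have s2 := troot_verts t2.
rewrite !mem_cat.
case: (boolP (x \in verts t1)) => hx /= hx2;
  case: (boolP (y \in verts t1)) => hy /= hy2.
- exact: h1.
- by rewrite (h1 x _ w1 hx s1) (h2 _ y w2 s2 hy2) addnC [X in _ + X = _]addnC addnA.
- by rewrite (h1 _ y w1 s1 hy) (h2 x _ w2 hx2 s2) addnC [X in _ + X = _]addnC addnA.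
- exact: h2.
Qed.

Lemma tdist_refl t x : tdist t x x = 0.
Proof. by elim: t x => //= e t1 h1 t2 h2 x; case: (x \in verts t1); [apply: h1|apply: h2]. Qed.

End Distance.

(** * The recurrence for heights, diameters and costs *)

(** These formulas are stated on numbers, with the decision for the edge as a boolean, so that they
    describe both edge sets and the candidates computed by the program. *)
Definition ht_merge (cut : bool) h1 h2 l := if cut then h1 else maxn h1 (h2 + l).

Definition dm_merge (cut : bool) h1 d1 h2 d2 l :=
  if cut then d1 else maxn (maxn d1 d2) (h1 + h2 + l).

Definition oc_merge (cut : bool) c1 c2 d2 := c1 + c2 + (if cut then d2 else 0).

Section Recurrence.
Variable I : instance.
Local Notation V := 'I_(nV I).
Local Notation E := 'I_(nE I).
Implicit Types (t : mtree I) (x y : V) (F : {set E}).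

(* Height and diameter of the component of the root in [t - F], and the sum of
   the diameters of the other components. *)
Fixpoint ht F t :=
  match t with
  | Leaf _ => 0
  | Node e t1 t2 => ht_merge (e \in F) (ht F t1) (ht F t2) (len e)
  end.

Fixpoint dm F t :=
  match t with
  | Leaf _ => 0
  | Node e t1 t2 =>
      dm_merge (e \in F) (ht F t1) (dm F t1) (ht F t2) (dm F t2) (len e)
  end.

Fixpoint oc F t :=
  match t with
  | Leaf _ => 0
  | Node e t1 t2 => oc_merge (e \in F) (oc F t1) (oc F t2) (dm F t2)
  end.

Lemma ht_spec F t : wf t ->
  (forall x, x \in rcomp F t -> tdist t (troot t) x <= ht F t) /\
  (exists2 x, x \in rcomp F t & tdist t (troot t) x = ht F t).
Proof.
elim: t => [v|e t1 IH1 t2 IH2] wt /=; first by split=> //; exists v; rewrite ?inE.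
have [_ _ w1 w2] := wt; have [le1 [x1 r1 e1]] := IH1 w1; have [le2 [x2 r2 e2]] := IH2 w2.
have n2 x : x \in rcomp F t2 -> (x \in verts t1) = false.
  by move/rcomp_verts=> h2; apply/negP => /(verts_disj wt)/(_ h2).
have v1 x : x \in rcomp F t1 -> x \in verts t1 by apply: rcomp_verts.
rewrite troot_verts /ht_merge; case: (e \in F); rewrite ?cats0.
  by split=> [x h|]; [rewrite v1 ?le1 | exists x1; rewrite ?v1].
split=> [x|].
  rewrite mem_cat => /orP[] h; first by rewrite v1 //; have := le1 x h; lia.
  by rewrite n2 // tdist_refl; have := le2 x h; lia.
case: (leqP (ht F t1) (ht F t2 + len e)) => h.
  by exists x2; rewrite ?mem_cat ?r2 ?orbT // n2 // tdist_refl; lia.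
by exists x1; rewrite ?mem_cat ?r1 // v1.
Qed.

(** When the edge is kept, a farthest pair lies within one part or joins two deepest vertices of the
    two parts, which [ht_spec] provides. *)
Lemma dm_spec F t : wf t ->
  (forall x y, x \in rcomp F t -> y \in rcomp F t -> tdist t x y <= dm F t) /\
  (exists x y, [/\ x \in rcomp F t, y \in rcomp F t & tdist t x y = dm F t]).
Proof.
elim: t => [v|e t1 IH1 t2 IH2] wt /=; first by split=> //; exists v, v; rewrite ?inE.
have [_ _ w1 w2] := wt.
have [le1 [x1 [y1 [rx1 ry1 e1]]]] := IH1 w1; have [le2 [x2 [y2 [rx2 ry2 e2]]]] := IH2 w2.
have [hle1 [z1 rz1 h1]] := ht_spec F w1; have [hle2 [z2 rz2 h2]] := ht_spec F w2.
have n2 x : x \in rcomp F t2 -> (x \in verts t1) = false.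
  by move/rcomp_verts=> hx; apply/negP => /(verts_disj wt)/(_ hx).
have v1 x : x \in rcomp F t1 -> x \in verts t1 by apply: rcomp_verts.
have s1 x : x \in rcomp F t1 -> tdist t1 x (troot t1) = tdist t1 (troot t1) x.
  by move=> h; apply: tdist_sym => //; [apply: v1|apply: troot_verts].
have s2 x : x \in rcomp F t2 -> tdist t2 x (troot t2) = tdist t2 (troot t2) x.
  by move=> h; apply: tdist_sym => //; [apply: rcomp_verts h|apply: troot_verts].
rewrite /dm_merge; case: (e \in F); rewrite ?cats0.
  by split=> [x y hx hy|]; [rewrite !v1 ?le1 | exists x1, y1; rewrite !v1].
split=> [x y|].
  rewrite !mem_cat => /orP[] hx /orP[] hy.
  - by rewrite !v1 //; have := le1 x y hx hy; lia.
  - by rewrite v1 // n2 // s1 //; have := hle1 x hx; have := hle2 y hy; lia.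
  - by rewrite n2 // v1 // s2 //; have := hle2 x hx; have := hle1 y hy; lia.
  - by rewrite !n2 //; have := le2 x y hx hy; lia.
case: (leqP (maxn (dm F t1) (dm F t2)) (ht F t1 + ht F t2 + len e)) => hm.
  exists z1, z2; rewrite !mem_cat rz1 rz2 orbT; split=> //.
  by rewrite v1 // n2 // s1 //; lia.
case: (leqP (dm F t1) (dm F t2)) => hm'.
  by exists x2, y2; rewrite !mem_cat rx2 ry2 !orbT; split=> //; rewrite !n2.
by exists x1, y1; rewrite !mem_cat rx1 ry1; split=> //; rewrite !v1.
Qed.

Lemma eq_seq_diam (f g : V -> V -> nat) (s : seq V) :
  {in s &, f =2 g} -> seq_diam f s = seq_diam g s.
Proof.
move=> fg; apply: eq_big_seq => x xs; apply: eq_big_seq => y ys; exact: fg.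
Qed.

Lemma seq_diam_rcomp F t : wf t -> seq_diam (tdist t) (rcomp F t) = dm F t.
Proof.
move=> wt; have [le [x [y [hx hy exy]]]] := dm_spec F wt.
apply/eqP; rewrite eqn_leq; apply/andP; split.
  by apply/bigmax_leqP_seq => a ha _; apply/bigmax_leqP_seq => b hb _; apply: le.
rewrite -exy; apply: leq_trans (leq_bigmax_seq _ hx isT).
exact: leq_bigmax_seq.
Qed.

Lemma sum_ocomps F t : wf t ->
  \sum_(s <- ocomps F t) seq_diam (tdist t) s = oc F t.
Proof.
elim: t => [v|e t1 IH1 t2 IH2] wt; first by rewrite /= big_nil.
have [_ _ w1 w2] := wt.
have in1 s x : s \in ocomps F t1 -> x \in s -> x \in verts t1.
  by move=> hs; apply: (@comps_verts _ F); rewrite in_comps hs orbT.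
have in2 s x : s \in comps F t2 -> x \in s -> (x \in verts t1) = false.
  by move=> hs /(comps_verts hs) h2; apply/negP => /(verts_disj wt)/(_ h2).
rewrite /= !big_cat /= -IH1 // -IH2 // /oc_merge -addnA; congr (_ + (_ + _)).
- apply: eq_big_seq => s hs; apply: eq_seq_diam => x y hx hy.
  by rewrite /= !(in1 s).
- apply: eq_big_seq => s hs; apply: eq_seq_diam => x y hx hy.
  by rewrite /= !(in2 s) // in_comps hs orbT.
- case: (e \in F); rewrite ?big_nil // big_seq1 -seq_diam_rcomp //.
  apply: eq_seq_diam => x y hx hy.
  by rewrite /= !(in2 (rcomp F t2)) // in_comps eqxx.
Qed.

Lemma cost_mtree F t : simple_graph I -> connected_graph I -> wf t ->
  (forall x, x \in verts t) -> (forall e, e \in edges t) ->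
  cost F = oc F t + dm F t.
Proof.
move=> sg cg wt hV hE; rewrite (cost_comps F wt hV hE) /comps big_cons addnC.
have dE s : seq_diam (@dist I) s = seq_diam (tdist t) s.
  by apply: eq_seq_diam => x y _ _; apply: dist_tdist.
rewrite dE seq_diam_rcomp // -sum_ocomps //; congr (_ + _).
by apply: eq_bigr => s _.
Qed.

Lemma joins_ends (f : E) : joins f (ends f).1 (ends f).2.
Proof. by rewrite /joins -surjective_pairing eqxx. Qed.

Lemma edges_uniq t : wf t -> uniq (edges t).
Proof.
elim: t => //= e t1 h1 t2 h2 wt; have [je _ w1 w2] := wt.
rewrite cat_uniq h1 // h2 // mem_cat negb_or !andbT -andbA; apply/and3P; split.
- apply/negP => h; have /andP[_ r2] := edges_verts w1 h je.
  exact: (verts_disj wt r2 (troot_verts t2)).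
- apply/negP => h; have /andP[r1 _] := edges_verts w2 h je.
  exact: (verts_disj wt (troot_verts t1) r1).
- apply/hasPn => f f2; apply/negP => /= f1.
  have /andP[v1 _] := edges_verts w1 f1 (joins_ends f).
  have /andP[v2 _] := edges_verts w2 f2 (joins_ends f).
  exact: (verts_disj wt v1 v2).
Qed.

Lemma ht_le_dm F t : ht F t <= dm F t.
Proof.
elim: t => //= e t1 h1 t2 h2; rewrite /ht_merge /dm_merge; case: (e \in F); lia.
Qed.

(** Each edge is charged once: if it is kept, [h1 + h2 + l] is at most [d1 + d2 + l] because heights
    do not exceed diameters. This bound justifies discarding expensive entries. *)
Lemma dm_oc_edges F t : dm F t + oc F t <= \sum_(e <- edges t) len e.
Proof.
elim: t => [v|e t1 h1 t2 h2] //=; rewrite big_cons big_cat /=.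
have := ht_le_dm F t1; have := ht_le_dm F t2.
rewrite /dm_merge /oc_merge; case: (e \in F); lia.
Qed.

Lemma dm_oc_total F t : wf t -> dm F t + oc F t <= total_length I.
Proof.
move=> wt; apply: leq_trans (dm_oc_edges F t) _.
rewrite big_uniq ?edges_uniq //= /total_length [X in _ <= X](bigID (mem (edges t))) /=.
exact: leq_addr.
Qed.

End Recurrence.

(** * Leaf elimination *)

Section Elimination.
Variable I : instance.
Local Notation V := 'I_(nV I).
Local Notation E := 'I_(nE I).
Implicit Types (t : mtree I) (x y u v w : V) (e f : E).
Implicit Types (R : {set E}) (A : {set V}) (tau : V -> mtree I) (rep : V -> V).

Definition star R v := [set e in R | ((ends e).1 == v) || ((ends e).2 == v)].

Lemma in_star R e v : e \in R -> reflect (exists w, joins e v w) (e \in star R v).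
Proof.
move=> eR; rewrite inE eR /= /joins; case: (ends e) => a b /=; apply: (iffP orP).
  by case=> /eqP->; [exists b | exists a]; rewrite !xpair_eqE !eqxx ?orbT.
by case=> w; rewrite !xpair_eqE => /orP[]/andP[h1 h2]; [left|right].
Qed.

(** If no vertex has degree 1 in [R], a simple path in [R] can be prolonged at its front forever,
    since acyclicity forbids meeting the path again. *)
Lemma exists_leaf R : simple_graph I -> acyclic_graph I -> R != set0 ->
  exists v, #|star R v| = 1.
Proof.
move=> [noloop uniqe] acyc /set0Pn[e0 e0R].
have [/existsP[v /eqP h]|no] := boolP [exists v, #|star R v| == 1]; first by exists v.
pose radj : rel V := [rel x y | [exists e in R, joins e x y]].
have subadj : subrel radj (adj set0).
  by move=> x y /existsP[e /andP[_ je]]; apply/existsP; exists e; rewrite inE.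
have radj_sym x y : radj x y -> radj y x.
  by case/existsP => e /andP[eR je]; apply/existsP; exists e; rewrite eR joins_sym.
(* The path has [k + 2] vertices, so [k = nV I] is already impossible. *)
have long k : exists x y q, [/\ path radj x (y :: q), uniq (x :: y :: q) & size q = k].
  elim: k => [|k [x [y [q [hp hu sq]]]]].
    exists (ends e0).1, (ends e0).2, [::]; split=> //=.
      by rewrite andbT; apply/existsP; exists e0; rewrite e0R joins_ends.
    by rewrite inE noloop.
  have /existsP[e /andP[eR je]] : radj x y by case/andP: hp.
  have eS : e \in star R x by apply/in_star => //; exists y.
  have /existsP[f /andP[fS fe]] : [exists f, (f \in star R x) && (f != e)].
    apply: contraNT no; rewrite negb_exists => /forallP h.
    apply/existsP; exists x; apply/cards1P; exists e; apply/setP => f.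
    rewrite in_set1; have [->//|fe] := eqVneq f e.
    by have := h f; rewrite fe andbT => /negPf.
  have fR : f \in R by move: fS; rewrite inE => /andP[].
  have /(in_star _ fR)[z jf] := fS.
  have nzx : z != x.
    apply/eqP => zx; have := noloop f; move: jf; rewrite zx /joins.
    by case/orP => /eqP-> /=; rewrite eqxx.
  have nzy : z != y.
    by apply: contra fe => /eqP zy; rewrite zy in jf; rewrite (uniqe _ _ _ _ jf je).
  have rxz : radj x z by apply/existsP; exists f; rewrite fR.
  have [zq|nzq] := boolP (z \in q); last first.
    exists z, x, (y :: q); split; last by rewrite /= sq.
      by rewrite [path _ _ _]/= (radj_sym _ _ rxz).
    by rewrite cons_uniq hu andbT !inE !negb_or nzx nzy nzq.
  (* The new neighbour [z] of [x] lies on the path beyond [y]; the stretch from [x] to [z] closes to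
     a cycle of at least three vertices. *)
  case/splitPr: zq hp hu sq => q1 q2 hp hu _.
  case: (acyc (x :: y :: rcons q1 z)); first by rewrite /= size_rcons.
  apply/andP; split.
    apply: (sub_path subadj); rewrite -rcons_cons rcons_path.
    move: hp; rewrite -cat_rcons -cat_cons cat_path => /andP[-> _].
    by rewrite /= last_rcons; apply: radj_sym.
  by move: hu; rewrite -cat_rcons -!cat_cons cat_uniq => /andP[].
have [x [y [q [_ hu sq]]]] := long (nV I).
move/card_uniqP: hu => /= hc; have := max_card (mem [:: x, y & q]).
by rewrite hc card_ord sq; lia.
Qed.

(* The state of the elimination: [R] is the set of remaining edges, [A] the set
   of remaining vertices, [tau w] the tree already collected at [w \in A] and
   [rep x] the remaining vertex whose tree contains [x]. *)
Record forest R A tau rep : Prop := Forest {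
  forest_rep : forall x, rep x \in A;
  forest_root : forall w, w \in A -> troot (tau w) = w;
  forest_wf : forall w, w \in A -> wf (tau w);
  forest_verts : forall w x, w \in A -> (x \in verts (tau w)) = (rep x == w);
  forest_edges : forall w e, w \in A ->
    (e \in edges (tau w)) = (e \notin R) && (rep (ends e).1 == w);
  forest_ends : forall e, e \in R -> ((ends e).1 \in A) && ((ends e).2 \in A)
}.

Lemma forest0 : forest setT setT (@Leaf I) id.
Proof.
by split=> // *; rewrite ?inE //= ?inE.
Qed.

Lemma forest_rep_id R A tau rep w : forest R A tau rep -> w \in A -> rep w = w.
Proof.
move=> fo wA; apply/eqP; rewrite -(forest_verts fo) // -{1}(forest_root fo wA).
exact: troot_verts.
Qed.

Lemma joins_mem R A tau rep e u v : forest R A tau rep -> e \in R ->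
  joins e u v -> (u \in A) && (v \in A).
Proof.
by move=> fo /(forest_ends fo) /andP[h1 h2] /orP[]/eqP E; rewrite E /= in h1 h2;
  rewrite h1 h2.
Qed.

Lemma star_joins R e u : star R u = [set e] -> exists v, joins e u v.
Proof.
move=> hs; have eS : e \in star R u by rewrite hs set11.
have eR : e \in R by move: eS; rewrite inE => /andP[].
by apply/(in_star _ eR).
Qed.

(** The two parts of the new node are disjoint because their vertices have different representatives
    [u] and [v]. *)
Lemma forest_step R A tau rep e u v : simple_graph I -> forest R A tau rep ->
  star R u = [set e] -> joins e u v ->
  forest (R :\ e) (A :\ u)
    (fun w => if w == v then Node e (tau v) (tau u) else tau w)
    (fun x => if rep x == u then v else rep x).
Proof.
move=> [noloop _] fo hs je.
have eR : e \in R.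
  have : e \in star R u by rewrite hs set11.
  by rewrite inE => /andP[].
have /andP[uA vA] := joins_mem fo eR je.
have nuv : u != v.
  apply/eqP => uv; have := noloop e; move: je; rewrite uv /joins.
  by case/orP => /eqP-> /=; rewrite eqxx.
have ru := forest_rep_id fo uA; have rv := forest_rep_id fo vA.
split.
- move=> x; rewrite !inE; case: ifPn => [_|->]; first by rewrite eq_sym nuv.
  exact: forest_rep fo x.
- move=> w; rewrite !inE => /andP[_ wA]; case: eqP => [->|_] /=; exact: (forest_root fo).
- move=> w; rewrite !inE => /andP[wu wA]; case: eqP => [wv|_]; last exact: (forest_wf fo).
  split; try exact: (forest_wf fo).
  + by rewrite !(forest_root fo) // joins_sym.
  + apply/hasPn => x; rewrite /= !(forest_verts fo) // => /eqP->.
    exact: nuv.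
- move=> w x; rewrite !inE => /andP[wu wA]; have [->|wv] := eqVneq w v.
    rewrite /= mem_cat !(forest_verts fo) //.
    by case: (eqVneq (rep x) u) => [_|_]; rewrite ?eqxx ?orbT ?orbF.
  rewrite (forest_verts fo) //; have [->|//] := eqVneq (rep x) u.
  by rewrite eq_sym (negPf wu) eq_sym (negPf wv).
- move=> w f; rewrite !inE => /andP[wu wA]; rewrite negb_and negbK.
  have [fe|fe] := eqVneq f e.
    have -> : (if rep (ends f).1 == u then v else rep (ends f).1) = v.
      by rewrite fe; case/orP: je => /eqP-> /=; rewrite ?ru ?rv ?eqxx // eq_sym (negPf nuv).
    have [wv|wv] := eqVneq w v; first by rewrite fe /= mem_head.
    by rewrite (forest_edges fo) // fe eR.
  have [->|wv] := eqVneq w v.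
    rewrite /= inE (negPf fe) mem_cat !(forest_edges fo) //.
    by case: (f \in R) => //=; case: (eqVneq (rep (ends f).1) u); rewrite ?eqxx ?orbT ?orbF.
  rewrite (forest_edges fo) //; case: (f \in R) => //=.
  have [->|//] := eqVneq (rep (ends f).1) u.
  by rewrite eq_sym (negPf wu) eq_sym (negPf wv).
- move=> f; rewrite !inE => /andP[fe fR]; have /andP[-> ->] := forest_ends fo fR.
  (* A remaining edge at [u] would belong to [star R u], hence be [e]. *)
  rewrite !andbT -negb_or; apply: contra fe => h.
  by rewrite -in_set1 -hs inE fR h.
Qed.

(** With no remaining edges, every edge lies in the tree collected at the representative of its
    endpoints, so [rep] is constant along edges and, by connectivity, everywhere. *)
Lemma forest_final A tau rep : connected_graph I -> forest set0 A tau rep ->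
  exists r, [/\ r \in A, forall w, w \in A -> w = r, wf (tau r),
    forall x, x \in verts (tau r) & forall e, e \in edges (tau r)].
Proof.
move=> [nV0 cg] fo; pose r := rep (Ordinal nV0).
have step x y : adj set0 x y -> rep x = rep y.
  case/existsP => e /andP[_ je]; have wA := forest_rep fo (ends e).1.
  have he : e \in edges (tau (rep (ends e).1)).
    by rewrite (forest_edges fo) // inE eqxx.
  have /andP[] := edges_verts (forest_wf fo wA) he je.
  by rewrite !(forest_verts fo) // => /eqP-> /eqP->.
have con x y : rep x = rep y.
  have /connectP[p hp ->] := cg x y.
  by elim: p x hp => //= z p IH x /andP[/step-> /IH].
exists r; have rA : r \in A := forest_rep fo _.
split=> //.
- by move=> w wA; rewrite -(forest_rep_id fo wA); apply: con.
- exact: (forest_wf fo).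
- by move=> x; rewrite (forest_verts fo) //; apply/eqP; apply: con.
- by move=> e; rewrite (forest_edges fo) // inE; apply/eqP; apply: con.
Qed.

Lemma spanning_card t : wf t -> (forall x, x \in verts t) ->
  (forall e, e \in edges t) -> nV I = (nE I).+1.
Proof.
move=> wt hV hE; have := size_verts t.
have -> : size (verts t) = nV I.
  rewrite -(card_uniqP (verts_uniq wt)) -[RHS]card_ord.
  by apply: eq_card => x; rewrite hV.
suff -> : size (edges t) = nE I by [].
rewrite -(card_uniqP (edges_uniq wt)) -[RHS]card_ord.
by apply: eq_card => x; rewrite hE.
Qed.

(** The elimination is run on sets alone; it ends in a spanning merge tree, for which the count is
    immediate. The number of rounds and the word bounds depend on it. *)
Lemma tree_card : is_tree I -> nV I = (nE I).+1.
Proof.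
move=> [sg cg ac].
suff elim_all k R A tau rep : #|R| = k -> forest R A tau rep ->
    exists A' tau' rep', forest set0 A' tau' rep'.
  have [A [tau [rep fo]]] := elim_all _ _ _ _ _ erefl forest0.
  have [r [_ _ wt hV hE]] := forest_final cg fo; exact: spanning_card wt hV hE.
elim: k R A tau rep => [|k IH] R A tau rep cR fo.
  by exists A, tau, rep; rewrite -(cards0_eq cR).
have R0 : R != set0 by rewrite -card_gt0 cR.
have [u /eqP/cards1P[e hs]] := exists_leaf sg ac R0.
have [v je] := star_joins hs; apply: IH (forest_step sg fo hs je).
have eR : e \in R by move: (set11 e); rewrite -hs inE => /andP[].
by apply/eqP; rewrite -eqSS -cR [in X in _ == X](cardsD1 e) eR.
Qed.

(** Used with [g] constantly 1 for the degrees and with [g] the edge number for the sums of incident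
    edges. *)
Lemma sum_star_add (g : E -> nat) R e v : e \notin R ->
  \sum_(f in star (e |: R) v) g f =
  (((ends e).1 == v) || ((ends e).2 == v)) * g e + \sum_(f in star R v) g f.
Proof.
move=> eR; have [inc|ninc] := boolP (((ends e).1 == v) || ((ends e).2 == v)).
  rewrite mul1n (_ : star (e |: R) v = e |: star R v); last first.
    by apply/setP => f; rewrite !inE andb_orl; case: eqP => [->|//]; rewrite inc.
  by rewrite big_setU1 // inE negb_and eR.
rewrite mul0n (_ : star (e |: R) v = star R v) //.
by apply/setP => f; rewrite !inE andb_orl; case: eqP => [->|//]; rewrite (negPf ninc) andbF.
Qed.

Lemma sum_star_del (g : E -> nat) R e v : e \in R ->
  \sum_(f in star R v) g f = (((ends e).1 == v) || ((ends e).2 == v)) * g e +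
  \sum_(f in star (R :\ e) v) g f.
Proof.
by move=> eR; rewrite -[in LHS](setD1K eR) sum_star_add // !inE eqxx.
Qed.

End Elimination.

(** * Initialisation *)

Declare Scope ram_scope.
Delimit Scope ram_scope with ram.
Notation "a + b" := (Bin Add a b) : ram_scope.
Notation "a - b" := (Bin Defs.Sub a b) : ram_scope.
Notation "a * b" := (Bin Mul a b) : ram_scope.
Notation "a <= b" := (Bin Leq a b) : ram_scope.
Notation "a == b" := (Bin Eqn a b) : ram_scope.
Notation "x ::= e" := (Assign x e%ram) (at level 70, no associativity) : ram_scope.
Notation "a @[ i ] ::= e" := (Store a i%ram e%ram)
  (at level 70, i at level 69, e at level 69, no associativity) : ram_scope.
Notation "c ;; d" := (Seq c d) (at level 90, right associativity) : ram_scope.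

(* Scalar variables: 2 holds L, 3 holds M = L + 1 and 4 holds S = M * M.
   Arrays: 5 degrees and 6 sums of the incident edges in the remaining graph,
   7 node of the tree collected at a vertex, 8 tables of the nodes; 16 and 17
   decode a table index [h * M + d] into [h] and [d]. *)
Definition scan_edge : com :=
  (2 ::= Var 2 + Get 2 (Var 5) ;;
   5 @[ Get 0 (Var 5) ] ::= Get 5 (Get 0 (Var 5)) + Const 1 ;;
   5 @[ Get 1 (Var 5) ] ::= Get 5 (Get 1 (Var 5)) + Const 1 ;;
   6 @[ Get 0 (Var 5) ] ::= Get 6 (Get 0 (Var 5)) + Var 5 ;;
   6 @[ Get 1 (Var 5) ] ::= Get 6 (Get 1 (Var 5)) + Var 5)%ram.

(** The machine has no division; quotients and remainders by [M] are produced by counting with a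
    carry. *)
Definition init_index : com :=
  (16 @[ Var 5 ] ::= Var 16 ;; 17 @[ Var 5 ] ::= Var 17 ;;
   17 ::= Var 17 + Const 1 ;;
   If (Var 17 == Var 3)%ram (17 ::= Const 0 ;; 16 ::= Var 16 + Const 1) Skip)%ram.

(** Vertices are their own nodes. The table of a single vertex has one entry, at height and diameter
    0, and its cost 0 is stored as 1. *)
Definition init_vertex : com :=
  (7 @[ Var 5 ] ::= Var 5 ;; 8 @[ Var 5 * Var 4 ] ::= Const 1)%ram.

Definition init_scalars : com :=
  (3 ::= Var 2 + Const 1 ;; 4 ::= Var 3 * Var 3 ;;
   16 ::= Const 0 ;; 17 ::= Const 0)%ram.

Definition setup : com :=
  (For 5 1 scan_edge ;; init_scalars ;; For 5 4 init_index ;;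
   For 5 0 init_vertex)%ram.

Definition tabsize (I : instance) := (total_length I).+1 * (total_length I).+1.

Lemma tabsize_gt (I : instance) : total_length I < tabsize I.
Proof. by rewrite /tabsize; nia. Qed.

(** The terms [n * S] account for table addresses, [n * n] for sums of edge numbers and [S] for
    products of two table values; the factor 20 is slack. *)
Definition roomy (I : instance) W :=
  20 * (nV I * tabsize I + nV I * nV I + 2 * nV I + tabsize I + 1) <= W.

Definition consts (I : instance) s :=
  [/\ [/\ var s 0 = nV I, var s 1 = nE I, var s 2 = total_length I,
          var s 3 = (total_length I).+1 & var s 4 = tabsize I],
      forall e : 'I_(nE I),
        [/\ arr s 0 e = (ends e).1, arr s 1 e = (ends e).2, arr s 2 e = len e
          & arr s 3 e = (e \in E0 I)]
    & forall q, q < tabsize I ->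
        arr s 16 q = q %/ (total_length I).+1 /\
        arr s 17 q = q %% (total_length I).+1].

Lemma consts_agree (I : instance) xs bs s s' :
  agree xs bs s s' -> all (fun x => x \notin xs) (iota 0 5) ->
  all (fun a => a \notin bs) [:: 0; 1; 2; 3; 16; 17] ->
  consts I s -> consts I s'.
Proof.
move=> [av aa] /allP hx /allP hb [[c0 c1 c2 c3 c4] ce cq]; split.
- by split; rewrite av // hx.
- by move=> e; have [? ? ? ?] := ce e; split; rewrite aa // hb.
- by move=> q /cq[? ?]; rewrite !aa ?hb.
Qed.

(** The degree 0 outside the vertices matters: the scan also visits numbers that are no vertices,
    and the leaf test must fail there. *)
Definition stars (I : instance) s (R : {set 'I_(nE I)}) :=
  (forall v : 'I_(nV I),
     arr s 5 v = \sum_(e in star R v) 1 /\ arr s 6 v = \sum_(e in star R v) (e : nat)) /\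
  forall k, nV I <= k -> arr s 5 k = 0.

Section Setup.
Variables (I : instance) (W : nat).
Hypothesis sg : simple_graph I.
Hypothesis card_I : nV I = (nE I).+1.
Hypothesis room : roomy I W.
Local Notation n := (nV I).
Local Notation m := (nE I).
Local Notation L := (total_length I).
Local Notation S := (tabsize I).

Lemma input_edge (e : 'I_m) :
  [/\ arr (input I) 0 e = (ends e).1, arr (input I) 1 e = (ends e).2,
      arr (input I) 2 e = len e & arr (input I) 3 e = (e \in E0 I)].
Proof. by split; rewrite /= /edge_cell valK. Qed.

Lemma sum_star_le (R : {set 'I_m}) v :
  \sum_(e in star R v) 1 <= m /\ \sum_(e in star R v) (e : nat) <= m * m.
Proof.
have h : \sum_(e in star R v) 1 <= m.
  by rewrite sum1_card -[X in _ <= X]card_ord; apply: max_card.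
split=> //; apply: leq_trans (_ : \sum_(e in star R v) m <= _).
  by apply: leq_sum => e _; apply: ltnW.
by rewrite -[X in \sum_(_ in _) X]mul1n -big_distrl /= leq_mul2r h orbT.
Qed.

Definition prefix_edges i := [set e : 'I_m | e < i].

Lemma prefix_edgesS (e : 'I_m) : prefix_edges e.+1 = e |: prefix_edges e.
Proof.
apply/setP => f; rewrite !inE ltnS leq_eqVlt; congr (_ || _).
Qed.

Lemma prefix_edges_total : prefix_edges m = setT.
Proof. by apply/setP => e; rewrite !inE ltn_ord. Qed.

Lemma sum_prefix_le i : \sum_(e in prefix_edges i) len e <= L.
Proof.
rewrite /total_length [X in _ <= X](bigID (mem (prefix_edges i))) /=.
exact: leq_addr.
Qed.

Lemma runs_scan :
  runs W (For 5 1 scan_edge) (input I) (for_time m (ctime scan_edge))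
    (fun s => var s 2 = L /\ stars s [set: 'I_m]).
Proof.
have hW := room; rewrite /roomy in hW.
apply: runs_weaken (leqnn _) _ (runs_for (N := m)
  (Inv := fun i s => var s 2 = \sum_(e in prefix_edges i) len e /\
     stars s (prefix_edges i)) _ _ _ _ _) => //.
- move=> s _ []; rewrite prefix_edges_total => h2 hs; split=> //.
  by rewrite h2; apply: eq_bigl => e; rewrite inE.
- by move: hW card_I; clear; lia.
- have -> : prefix_edges 0 = set0 by apply/setP => e; rewrite !inE.
  have star0 v : star set0 v = set0 :> {set 'I_m}.
    by apply/setP => e; rewrite !inE.
  by rewrite big_set0; split=> //; split=> // v; rewrite star0 !big_set0.
move=> i s im hi [_ ag] [h2 [hs h0]]; apply: runs_wp.
pose e := Ordinal im; have ie : i = e by [].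
have [i0 i1 i2 _] := input_edge e.
have a0 : arr s 0 i = (ends e).1 by rewrite (ag 0 isT).
have a1 : arr s 1 i = (ends e).2 by rewrite (ag 1 isT).
have a2 : arr s 2 i = len e by rewrite (ag 2 isT).
(* Without loops the two updates of each array hit different cells. *)
have ne := sg.1 e; rewrite -val_eqE /= in ne.
have [d1 s1] := hs (ends e).1; have [d2 s2] := hs (ends e).2.
have [b1 c1] := sum_star_le (prefix_edges i) (ends e).1.
have [b2 c2] := sum_star_le (prefix_edges i) (ends e).2.
have lE : \sum_(f in prefix_edges i.+1) len f = len e + \sum_(f in prefix_edges i) len f.
  by rewrite (prefix_edgesS e) big_setU1 //= inE ltnn.
have Lb := sum_prefix_le i.+1; have LS := tabsize_gt I; rewrite lE in Lb.
have v1 := ltn_ord (ends e).1; have v2 := ltn_ord (ends e).2.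
have ne' : (nat_of_ord (ends e).2 == (ends e).1) = false.
  by rewrite eq_sym; apply: negPf.
rewrite /= hi a0 a1 a2 h2 d1 s1 ne' d2 s2.
have mm : m * m <= n * n by rewrite card_I; nia.
have im' : i < m by [].
do 5 (split; first by move: hW card_I b1 b2 c1 c2 Lb LS v1 v2 im' mm; clear; lia).
split; first by rewrite lE addnC.
split=> [v|k kn] /=.
  have eR : e \notin prefix_edges e by rewrite inE ltnn.
  rewrite (prefix_edgesS e) !sum_star_add // muln1 -!val_eqE /=.
  have [<- <-] := hs v; rewrite !(eq_sym (nat_of_ord v)).
  case: eqP => [e2|_] /=.
    have -> : v = (ends e).2 by apply: val_inj.
    by rewrite d2 s2 orbT mul1n [in LHS]addnC; split=> //; rewrite addnC.
  case: eqP => [e1|_] //=.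
  have -> : v = (ends e).1 by apply: val_inj.
  by rewrite d1 s1 mul1n [in LHS]addnC; split=> //; rewrite addnC.
have -> : (k == (ends e).2) = false by move: kn v2; clear; lia.
have -> : (k == (ends e).1) = false by move: kn v1; clear; lia.
exact: h0.
Qed.

Definition setup_time :=
  for_time m (ctime scan_edge) + (ctime init_scalars +
    (for_time S (ctime init_index) + for_time n (ctime init_vertex))).

Lemma runs_setup :
  runs W setup (input I) setup_time
    (fun s => [/\ consts I s, stars s [set: 'I_m],
       forall v : 'I_n, arr s 7 v = v
     & forall q, arr s 8 q = (q < n * S) && (S %| q)]).
Proof.
have hW := room; rewrite /roomy in hW; have LS := tabsize_gt I.
apply: runs_seq; apply: runs_weaken runs_scan => // s1 _ [L1 st1] [fv1 fa1].
apply: runs_seq; apply: runs_wp.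
have SE : S = (L + 1) * (L + 1) by rewrite /tabsize addn1.
rewrite /= L1 -SE; do 2 (split; first by move: hW LS; clear; lia).
do 2 (split; first by []).
set s2 := set_var _ _ _ => _.
apply: runs_seq.
apply: (runs_weaken (leqnn _) _ (runs_for (N := S) (Inv := fun i s =>
   [/\ forall q, q < i -> arr s 16 q * L.+1 + arr s 17 q = q /\ arr s 17 q < L.+1,
       var s 16 * L.+1 + var s 17 = i & var s 17 < L.+1]) _ _ _ _ _)) => //.
- move=> s3 [fv3 fa3] [tb _ _] [_ _].
  have c3 : consts I s3.
    split.
    - by split; rewrite fv3 //= ?fv1 // addn1.
    - move=> e; have [? ? ? ?] := input_edge e.
      by split; rewrite fa3 // /s2 /= fa1.
    - move=> q qS; have [h1 h2] := tb q qS.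
      rewrite -[in RHS]h1 divnMDl // divn_small // addn0.
      by rewrite -[in X in _ /\ _ = X]h1 modnMDl modn_small.
  have st3 : stars s3 [set: 'I_m].
    by case: st1 => st0 st1; split=> [v|k kn]; rewrite !fa3 // /s2 /=; auto.
  have z3 q : arr s3 8 q = 0 by rewrite fa3 // /s2 /= fa1.
  have [[c30 _ _ _ c34] _ _] := c3.
  apply: (runs_weaken (leqnn _) _ (runs_for (N := n) (Inv := fun i s =>
     (forall k, k < i -> arr s 7 k = k) /\
     (forall q, arr s 8 q = (q < i * S) && (S %| q))) _ _ _ _ _)) => //.
  + move=> s4 ag4 [h7 h8]; split.
    * exact: consts_agree ag4 isT isT c3.
    * case: st3 => st0 st3'; split=> [v|k kn]; rewrite !ag4.2 //; auto.
    * by move=> v; apply: h7.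
    * exact: h8.
  + by move: hW; clear; lia.
  move=> i s4 iN hi [fv4 fa4] [h7 h8]; apply: runs_wp.
  have v4 : var s4 4 = S by rewrite fv4.
  have iS : i * S <= n * S by rewrite leq_mul2r ltnW ?orbT.
  rewrite /= hi v4; split; first by move: hW iN; clear; lia.
  split; first by move: hW iN iS; clear; lia.
  split=> [k|q]; first by rewrite ltnS leq_eqVlt; case: eqP => //= _; apply: h7.
  have S0 : 0 < S by [].
  case: eqP => [->|nq]; first by rewrite dvdn_mull // ltn_pmul2r // ltnSn.
  rewrite h8; case: (boolP (S %| q)) => [/dvdnP[k ek]|]; last by rewrite !andbF.
  rewrite ek !ltn_pmul2r // !andbT.
  have ki : k <> i by move=> ki; apply: nq; rewrite ek ki.
  by move: ki; clear; lia.
- by move: hW; clear; lia.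
move=> i s3 iS hi [fv3 fa3] [tb hd dlt]; apply: runs_wp.
have v3 : var s3 3 = L.+1 by rewrite fv3 //= addn1.
have h16 : var s3 16 <= i by rewrite -hd; clear; nia.
have tb' q h d : h * L.+1 + d = i -> d < L.+1 -> q < i.+1 ->
    (if q == i then h else arr s3 16 q) * L.+1 + (if q == i then d else arr s3 17 q) = q
    /\ (if q == i then d else arr s3 17 q) < L.+1.
  by move=> hdi dL; rewrite ltnS leq_eqVlt; case: eqP => [->//|_] /= /tb.
rewrite /= hi v3.
do 3 (split; first by move: hW iS LS dlt h16; clear; lia).
split; first by move: hW iS LS dlt h16; clear; lia.
- rewrite eqb0 negbK => /eqP d1; split=> //; split; first by move: hW iS LS dlt h16; clear; lia.
  split=> //; first by move=> q; apply: tb'.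
  move: d1 hd; clear; nia.
- move/eqP; rewrite eqb0 => d1; split=> //.
  + by move=> q; apply: tb'.
  + by move: hd; clear; lia.
  + by move: d1 dlt; clear; lia.
Qed.
End Setup.

(** * Merging two tables *)

(* A table maps the index [h * M + d] to one plus the least sum of the
   diameters of the closed components when the component of the root has height
   [h] and diameter [d], and to 0 when there is no such set of removed edges.
   Arrays 12, 13 and 14 record the two entries an optimum comes from and
   whether the edge is cut.  Variables 12, 13 and 14 hold the offsets of the two
   tables and of their merge, 15 the length of the edge, and 16, 17 and 18 the
   height, diameter and value of a candidate. *)
Definition candidate (cut : bool) : com :=
  if cut then
    (16 ::= Get 16 (Var 5) ;; 17 ::= Get 17 (Var 5) ;;
     18 ::= Get 8 (Var 12 + Var 5) + Get 8 (Var 13 + Var 6) - Const 1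
            + Get 17 (Var 6))%ram
  else
    (16 ::= Get 16 (Var 6) + Var 15 ;;
     If (Var 16 <= Get 16 (Var 5))%ram (16 ::= Get 16 (Var 5)) Skip ;;
     17 ::= Get 16 (Var 5) + Get 16 (Var 6) + Var 15 ;;
     If (Var 17 <= Get 17 (Var 5))%ram (17 ::= Get 17 (Var 5)) Skip ;;
     If (Var 17 <= Get 17 (Var 6))%ram (17 ::= Get 17 (Var 6)) Skip ;;
     18 ::= Get 8 (Var 12 + Var 5) + Get 8 (Var 13 + Var 6) - Const 1)%ram.

(** Variable 18 is one plus a cost, so the test asks for a height of at most [L] and for cost plus
    diameter of at most [L]; in particular [h * M + d] is then a valid index. The product and the
    sum of truth values act as conjunction and disjunction. *)
Definition record (cut : bool) : com :=
  If ((Var 16 <= Var 2) * (Var 18 + Var 17 <= Var 3))%ram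
    (19 ::= Var 14 + (Var 16 * Var 3 + Var 17) ;;
     If ((Get 8 (Var 19) == Const 0) + (Var 18 <= Get 8 (Var 19)))%ram
       (8 @[ Var 19 ] ::= Var 18 ;; 12 @[ Var 19 ] ::= Var 5 ;;
        13 @[ Var 19 ] ::= Var 6 ;; 14 @[ Var 19 ] ::= Const cut)
       Skip)%ram
    Skip.

Definition update cut : com := (candidate cut ;; record cut)%ram.

Definition merge_body : com :=
  If (Get 8 (Var 12 + Var 5) * Get 8 (Var 13 + Var 6))%ram
    (update false ;; If (Get 3 (Var 11)) (update true) Skip)%ram Skip.

Definition merge_init : com :=
  (12 ::= Get 7 (Var 8) * Var 4 ;; 13 ::= Get 7 (Var 7) * Var 4 ;;
   14 ::= Var 10 * Var 4 ;; 15 ::= Get 2 (Var 11))%ram.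

Definition merge : com :=
  (merge_init ;; For 5 4 (For 6 4 merge_body))%ram.

Section MergeTables.
Variables (I : instance).
Local Notation n := (nV I).
Local Notation L := (total_length I).
Local Notation S := (tabsize I).

Definition hof q := q %/ L.+1.
Definition dof q := q %% L.+1.

Definition cand_h cut i j l := ht_merge cut (hof i) (hof j) l.
Definition cand_d cut i j l := dm_merge cut (hof i) (dof i) (hof j) (dof j) l.
(** Both values carry the shift by one; one of the shifts is removed. *)
Definition cand_c cut a b j := a + b - 1 + (if cut then dof j else 0).

(** Soundness of a table: the recorded pointers explain an entry by an admissible combination with
    exactly this height, diameter and value. Minimality is expressed separately by [covers]. *)
Definition entry_ok (T1 T2 : nat -> nat) (e : 'I_(nE I)) s K q :=
  exists i j (cut : bool),
    [/\ [/\ arr s 12 (K * S + q) = i, arr s 13 (K * S + q) = j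
          & arr s 14 (K * S + q) = cut],
        [/\ i < S, j < S, T1 i != 0, T2 j != 0 & cut ==> (e \in E0 I)],
        cand_h cut i j (len e) = hof q, cand_d cut i j (len e) = dof q
      & arr s 8 (K * S + q) = cand_c cut (T1 i) (T2 j) j].

Definition covers (T1 T2 : nat -> nat) (e : 'I_(nE I)) s K i j cut :=
  cut ==> (e \in E0 I) -> T1 i != 0 -> T2 j != 0 ->
  cand_h cut i j (len e) <= L ->
  cand_c cut (T1 i) (T2 j) j + cand_d cut i j (len e) <= L.+1 ->
  0 < arr s 8 (K * S + (cand_h cut i j (len e) * L.+1 + cand_d cut i j (len e)))
    <= cand_c cut (T1 i) (T2 j) j.

Definition node_ok T1 T2 e s K :=
  (forall q, q < S -> arr s 8 (K * S + q) != 0 -> entry_ok T1 T2 e s K q) /\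
  (forall i j cut, i < S -> j < S -> covers T1 T2 e s K i j cut).

Lemma hof_lt q : q < S -> hof q < L.+1.
Proof. by move=> qS; rewrite /hof ltn_divLR. Qed.

Lemma dof_lt q : dof q < L.+1.
Proof. by rewrite /dof ltn_pmod. Qed.

Lemma hof_index h d : d < L.+1 -> hof (h * L.+1 + d) = h.
Proof. by move=> dL; rewrite /hof divnMDl // divn_small ?addn0. Qed.

Lemma dof_index h d : d < L.+1 -> dof (h * L.+1 + d) = d.
Proof. by move=> dL; rewrite /dof modnMDl modn_small. Qed.

Lemma index_lt h d : h < L.+1 -> d < L.+1 -> h * L.+1 + d < S.
Proof. by rewrite /tabsize => hL dL; nia. Qed.

Lemma cells_lt k K q : k < K -> q < S -> k * S + q < K * S.
Proof. by move=> kK qS; nia. Qed.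

Section Body.
Variables (W : nat) (s0 : state) (e : 'I_(nE I)) (k1 k2 K : nat).
Hypothesis room : roomy I W.
Hypothesis consts0 : consts I s0.
Hypothesis vars0 :
  [/\ var s0 11 = e, var s0 12 = k1 * S, var s0 13 = k2 * S, var s0 14 = K * S
    & var s0 15 = len e].
Hypothesis lt1 : k1 < K.
Hypothesis lt2 : k2 < K.
Hypothesis ltK : K < 2 * n.
Hypothesis low : forall q, arr s0 8 q <= L.+1.
Hypothesis fresh : forall q, K * S <= q -> arr s0 8 q = 0.
Hypothesis ltE : nE I < n.

(** Read in the state before the loops: these cells lie below [K * S], and only the table of [K] is
    written. *)
Let T1 i := arr s0 8 (k1 * S + i).
Let T2 i := arr s0 8 (k2 * S + i).

(** The set [done] of treated combinations is a parameter, so that one invariant serves both nested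
    loops and the two updates within the body. *)
Definition minv (done : nat -> nat -> bool -> Prop) s :=
  [/\ forall q, q < K * S ->
        [/\ arr s 8 q = arr s0 8 q, arr s 12 q = arr s0 12 q,
            arr s 13 q = arr s0 13 q & arr s 14 q = arr s0 14 q],
      forall q, K.+1 * S <= q -> arr s 8 q = 0,
      forall q, arr s 8 q <= L.+1,
      forall q, q < S -> arr s 8 (K * S + q) != 0 -> entry_ok T1 T2 e s K q
    & forall i j cut, done i j cut -> i < S -> j < S -> covers T1 T2 e s K i j cut].

Definition loop_vars := [:: 5; 6; 16; 17; 18; 19].
Definition loop_arrs := [:: 8; 12; 13; 14].

Lemma KS_le : K * S + S <= 2 * (n * S).
Proof. by move: ltK; clear; nia. Qed.

Lemma wp_candidate cut s i j done : minv done s -> agree loop_vars loop_arrs s0 s ->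
  var s 5 = i -> var s 6 = j -> i < S -> j < S ->
  wp W (candidate cut) (fun s' =>
    [/\ agree [:: 16; 17; 18] [::] s s',
        var s' 16 = cand_h cut i j (len e), var s' 17 = cand_d cut i j (len e)
      & var s' 18 = cand_c cut (T1 i) (T2 j) j]) s.
Proof.
move=> [tb _ lw _ _] ag v5 v6 iS jS.
have [_ ce cq] := consts_agree ag isT isT consts0.
have [i16 i17] := cq i iS; have [j16 j17] := cq j jS.
have [f11 f12 f13 f14 f15] := vars0.
have v12 : var s 12 = k1 * S by rewrite ag.1.
have v13 : var s 13 = k2 * S by rewrite ag.1.
have v15 : var s 15 = len e by rewrite ag.1.
have t1 : arr s 8 (k1 * S + i) = T1 i.
  by have [-> _ _ _] := tb _ (cells_lt lt1 iS).
have t2 : arr s 8 (k2 * S + j) = T2 j.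
  by have [-> _ _ _] := tb _ (cells_lt lt2 jS).
have b1 : T1 i <= L.+1 by apply: low.
have b2 : T2 j <= L.+1 by apply: low.
have lL : len e <= L by rewrite /total_length (bigD1 e) //= leq_addr.
have [hi hj di dj] : [/\ hof i < L.+1, hof j < L.+1, dof i < L.+1 & dof j < L.+1].
  by split; rewrite ?hof_lt ?dof_lt.
have LS := tabsize_gt I; have hW := room; rewrite /roomy in hW.
have c1 := cells_lt lt1 iS; have c2 := cells_lt lt2 jS; have cK := KS_le.
rewrite -/(hof i) -/(dof i) in i16 i17; rewrite -/(hof j) -/(dof j) in j16 j17.
have frame3 a b c : agree [:: 16; 17; 18] [::] s
    (set_var (set_var (set_var s 16 a) 17 b) 18 c).
  by split=> //= x; rewrite !inE !negb_or => /and3P[/negPf-> /negPf-> /negPf->].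
rewrite /cand_h /cand_d /cand_c /ht_merge /dm_merge.
case: cut; rewrite /= ?v5 ?v6 ?v12 ?v13 ?v15 ?t1 ?t2 ?i16 ?i17 ?j16 ?j17.
  do 3 (split; first by move: hW LS b1 b2 iS jS c1 c2 cK hi hj di dj; clear; lia).
  by split=> //=; exact: frame3.
(* A single bound [B] absorbs all products, which leaves linear goals. *)
have [B [BW Bi Bj [Ba Bb] [Bk1 Bk2]]] : exists B, [/\ 4 * B <= W, i <= B, j <= B,
    T1 i <= L.+1 <= B /\ T2 j <= L.+1 <= B & k1 * S + i <= B /\ k2 * S + j <= B].
  exists (4 * (n * S) + S); move: hW LS b1 b2 iS jS c1 c2 cK; clear.
  by move=> *; do !split; lia.
move: BW Bi Bj Ba Bb Bk1 Bk2 hi hj di dj lL.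
move: (T1 i) (T2 j) (hof i) (hof j) (dof i) (dof j) (len e) (k1 * S) (k2 * S) L => a b.
clear => hi hj di dj l x y L *.
repeat match goal with
| |- agree _ _ _ _ => split=> //= z;
    rewrite !inE !negb_or => /and3P[/negPf-> /negPf-> /negPf->] //
| |- _ /\ _ => split
| |- and3 _ _ _ => split
| |- and4 _ _ _ _ => split
| |- _ -> _ => intro
end; lia.
Qed.

(** Adds the combinations for which [covers] holds without any work: empty entries, forbidden cuts
    and candidates that fail the size test. *)
Lemma minv_sub (done done' : nat -> nat -> bool -> Prop) s :
  (forall i j cut, done' i j cut -> i < S -> j < S ->
     done i j cut \/ covers T1 T2 e s K i j cut) ->
  minv done s -> minv done' s.
Proof.
by move=> hd [a b c d f]; split=> // i j cut h iS jS; case: (hd _ _ _ h iS jS) => // /f; apply.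
Qed.

(** A store fills an empty cell or does not increase a filled one, so whatever was covered before
    stays covered. *)
Lemma minv_store done s s' i j (cut : bool) :
  let h := cand_h cut i j (len e) in
  let d := cand_d cut i j (len e) in
  let c := cand_c cut (T1 i) (T2 j) j in
  let p := K * S + (h * L.+1 + d) in
  minv done s -> i < S -> j < S -> T1 i != 0 -> T2 j != 0 ->
  cut ==> (e \in E0 I) -> h <= L -> c + d <= L.+1 ->
  arr s 8 p = 0 \/ c <= arr s 8 p ->
  (forall q, arr s' 8 q = if q == p then c else arr s 8 q) ->
  (forall q, arr s' 12 q = if q == p then i else arr s 12 q) ->
  (forall q, arr s' 13 q = if q == p then j else arr s 13 q) ->
  (forall q, arr s' 14 q = if q == p then nat_of_bool cut else arr s 14 q) ->
  minv (fun i' j' c' => done i' j' c' \/ (i', j', c') = (i, j, cut)) s'.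
Proof.
move=> h d c p [tb fr lw so co] iS jS t1 t2 ce hL cd old e8 e12 e13 e14.
have c0 : 0 < c by rewrite /c /cand_c; move: t1 t2; clear; lia.
have dL : d < L.+1 by move: c0 cd; clear; lia.
have hL' : h < L.+1 by [].
have pS : h * L.+1 + d < S by apply: index_lt.
have np q : q < K * S -> (q == p) = false by rewrite /p; clear; lia.
split.
- by move=> q qK; rewrite e8 e12 e13 e14 np //; apply: tb.
- move=> q qK; rewrite e8; have -> : (q == p) = false; last exact: fr.
  by move: qK pS; rewrite /p; clear; lia.
- by move=> q; rewrite e8; case: eqP => // _; move: cd; clear; lia.
- move=> q qS; rewrite e8 /entry_ok e8 e12 e13 e14.
  have [qp _|nqp] := eqVneq (K * S + q) p; last exact: so.
  have -> : q = h * L.+1 + d by move: qp; rewrite /p; clear; lia.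
  by exists i, j, cut; rewrite hof_index // dof_index.
- move=> i' j' c' hd iS' jS' ce' t1' t2' hL2 cd2; rewrite e8; case: eqP => [E|nE].
    rewrite c0; case: hd => [hd|[-> -> ->]]; last by rewrite leqnn.
    have /andP[k0 k1'] := co _ _ _ hd iS' jS' ce' t1' t2' hL2 cd2.
    rewrite E in k0 k1'; case: old => h'; first by rewrite h' in k0.
    exact: leq_trans k1'.
  case: hd => [hd|[h1 h2 h3]]; first exact: co.
  by case: nE; rewrite /p /h /d h1 h2 h3.
Qed.

Lemma wp_record (cut : bool) done s i j : minv done s -> agree loop_vars loop_arrs s0 s ->
  var s 5 = i -> var s 6 = j -> i < S -> j < S -> T1 i != 0 -> T2 j != 0 ->
  cut ==> (e \in E0 I) ->
  var s 16 = cand_h cut i j (len e) -> var s 17 = cand_d cut i j (len e) ->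
  var s 18 = cand_c cut (T1 i) (T2 j) j ->
  wp W (record cut) (fun s' => agree [:: 19] loop_arrs s s' /\
    minv (fun i' j' c' => done i' j' c' \/ (i', j', c') = (i, j, cut)) s') s.
Proof.
move=> mi ag v5 v6 iS jS t1 t2 ce v16 v17 v18.
have [[_ _ v2 v3 v4] _ _] := consts_agree ag isT isT consts0.
have [f11 f12 f13 f14 f15] := vars0.
have v14 : var s 14 = K * S by rewrite ag.1.
have [_ _ lw _ _] := mi.
have b1 : T1 i <= L.+1 by apply: low.
have b2 : T2 j <= L.+1 by apply: low.
have lL : len e <= L by rewrite /total_length (bigD1 e) //= leq_addr.
have [hi hj di dj] : [/\ hof i < L.+1, hof j < L.+1, dof i < L.+1 & dof j < L.+1].
  by split; rewrite ?hof_lt ?dof_lt.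
have LS := tabsize_gt I; have hW := room; rewrite /roomy in hW.
have cK := KS_le.
have hb : cand_h cut i j (len e) <= 3 * L.
  by rewrite /cand_h /ht_merge; case: (cut); move: hi hj lL; clear; lia.
have db : cand_d cut i j (len e) <= 3 * L.
  by rewrite /cand_d /dm_merge; case: (cut); move: hi hj di dj lL; clear; lia.
have cb : cand_c cut (T1 i) (T2 j) j <= 3 * L.+1.
  by rewrite /cand_c; case: (cut); move: b1 b2 dj; clear; lia.
rewrite /= v2 v3 v5 v6 v14 v16 v17 v18.
set h := cand_h _ _ _ _ in hb v16 *; set d := cand_d _ _ _ _ in db v17 *.
set c := cand_c _ _ _ _ in cb v18 *.
split.
- by move: hW LS hb db cb; clear; nia.
- rewrite muln_eq0 negb_or !eqb0 !negbK => /andP[hL cd].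
  have pS : h * L.+1 + d < S.
    by apply: index_lt; move: cd hL; rewrite /c /cand_c; move: t1 t2; clear; lia.
  have hM : h * L.+1 < S by move: pS; clear; lia.
  split; first by move: hW LS hb db cb cK pS hM; clear; lia.
  have l8 := lw (K * S + (h * L.+1 + d)).
  split.
  + by move: hW LS hb db cb cK pS hM l8; clear; lia.
  + move=> cond.
    do 4 (split; first by move: hW LS hb db cb cK pS hM l8 iS jS; clear; case: (cut); lia).
    split.
      split=> [x|a] /=; first by rewrite inE => /negPf->.
      by rewrite /loop_arrs !inE !negb_or => /and4P[/negPf-> /negPf-> /negPf-> /negPf->].
    apply: (@minv_store done s _ i j cut) => //.
    rewrite -/h -/d -/c; move: (arr s 8 _) cond => [|x]; first by left.
    by case: leqP => // cx _; right.
  (* The cell already holds a smaller value, which covers the candidate. *)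
  + move=> cond; split.
      by split=> [x|a] //=; rewrite inE => /negPf->.
    have [tb fr _ so co] := mi; split=> // i' j' c' hd iS' jS' ce' t1' t2' hL2 cd2 /=.
    case: hd => [hd|[-> -> ->]]; first exact: co.
    rewrite -/h -/d -/c; move: (arr s 8 _) cond => [//|x].
    by case: (leqP c x.+1) => // /ltnW->.
(* The candidate fails the size test, so [covers] asks nothing of it. *)
- move=> cond; split; first by [].
  apply: minv_sub mi => i' j' c' [h'|[-> -> ->]] _ _; first by left.
  right=> _ _ _; rewrite -/h -/d -/c; move: cond; clear.
  by case: (h <= L) => //; case: (c + d <= L.+1).
Qed.

Lemma wp_update (cut : bool) done s i j :
  minv done s -> agree loop_vars loop_arrs s0 s ->
  var s 5 = i -> var s 6 = j -> i < S -> j < S -> T1 i != 0 -> T2 j != 0 ->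
  cut ==> (e \in E0 I) ->
  wp W (update cut) (fun s' => [/\ agree loop_vars loop_arrs s0 s', var s' 5 = i,
    var s' 6 = j &
    minv (fun i' j' c' => done i' j' c' \/ (i', j', c') = (i, j, cut)) s']) s.
Proof.
move=> mi ag v5 v6 iS jS t1 t2 ce.
apply: wp_seq (wp_candidate cut mi ag v5 v6 iS jS) _ => s1 [ag1 v16 v17 v18].
have ag1' : agree loop_vars loop_arrs s0 s1.
  apply: agree_trans ag _; apply: agree_sub ag1 => // x; rewrite /loop_vars !inE.
  by case/or3P => ->; rewrite ?orbT.
have mi1 : minv done s1.
  have [tb fr lw so co] := mi; split.
  - by move=> q qK; rewrite !ag1.2 //; apply: tb.
  - by move=> q qK; rewrite !ag1.2 //; apply: fr.
  - by move=> q; rewrite !ag1.2.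
  - by move=> q qS; rewrite /entry_ok !ag1.2 //; apply: so.
  - by move=> i' j' c'; rewrite /covers !ag1.2 //; apply: co.
have w5 : var s1 5 = i by rewrite ag1.1.
have w6 : var s1 6 = j by rewrite ag1.1.
apply: wp_conseq (wp_record mi1 ag1' w5 w6 iS jS t1 t2 ce v16 v17 v18).
move=> s2 [ag2 mi2]; split=> //; try by rewrite ag2.1.
apply: agree_trans ag1' _; apply: agree_sub ag2 => // x; rewrite /loop_vars !inE.
by move->; rewrite !orbT.
Qed.

Lemma wp_merge_body done s i j : minv done s -> agree loop_vars loop_arrs s0 s ->
  var s 5 = i -> var s 6 = j -> i < S -> j < S ->
  wp W merge_body
    (minv (fun i' j' c' => done i' j' c' \/ (i' = i /\ j' = j))) s.
Proof.
move=> mi ag v5 v6 iS jS.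
have [_ ce _] := consts_agree ag isT isT consts0.
have [f11 f12 f13 f14 f15] := vars0.
have v11 : var s 11 = e by rewrite ag.1.
have v12 : var s 12 = k1 * S by rewrite ag.1.
have v13 : var s 13 = k2 * S by rewrite ag.1.
have [tb _ lw _ _] := mi.
have t1 : arr s 8 (k1 * S + i) = T1 i.
  by have [-> _ _ _] := tb _ (cells_lt lt1 iS).
have t2 : arr s 8 (k2 * S + j) = T2 j.
  by have [-> _ _ _] := tb _ (cells_lt lt2 jS).
have b1 : T1 i <= L.+1 by apply: low.
have b2 : T2 j <= L.+1 by apply: low.
have b12 : T1 i * T2 j <= S by apply: leq_mul.
have hW := room; rewrite /roomy in hW; have LS := tabsize_gt I.
have c1 := cells_lt lt1 iS; have c2 := cells_lt lt2 jS; have cK := KS_le.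
split.
- rewrite /= v5 v6 v12 v13 t1 t2.
  by move: hW LS b1 b2 b12 c1 c2 cK iS jS; clear; lia.
- rewrite [eval _ _]/= v5 v6 v12 v13 t1 t2 muln_eq0 negb_or => /andP[n1 n2].
  apply: wp_seq (@wp_update false done s i j mi ag v5 v6 iS jS n1 n2 isT) _.
  move=> s1 [ag1 w5 w6 mi1].
  have [_ ce1 _] := consts_agree ag1 isT isT consts0; have [_ _ _ a3] := ce1 e.
  have w11 : var s1 11 = e by rewrite ag1.1.
  split.
  + rewrite /= w11 a3; move: hW (ltn_ord e) ltE; clear; case: (e \in _); lia.
  + rewrite [eval _ _]/= w11 a3 eqb0 negbK => eE.
    apply: wp_conseq (@wp_update true _ s1 i j mi1 ag1 w5 w6 iS jS n1 n2 eE).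
    move=> s2 [_ _ _ mi2]; apply: minv_sub mi2 => i' j' c' [h|[-> ->]] _ _; left.
      by left; left.
    by case: c'; [right|left; right].
  (* Outside [E0] a cut is not admissible, and its combination is covered vacuously. *)
  + rewrite /= w11 a3 => /eqP; rewrite eqb0 => neE.
    apply: minv_sub mi1 => i' j' c' [h|[-> ->]] _ _; first by left; left.
    case: c'; last by left; right.
    by right; rewrite /covers /= (negPf neE).
- rewrite /= v5 v6 v12 v13 t1 t2 => /eqP; rewrite muln_eq0 => n12.
  apply: minv_sub mi => i' j' c' [h|[-> ->]] _ _; first by left.
  by right=> _ /negPf n1 /negPf n2; rewrite n1 n2 in n12.
Qed.

Definition merge_loops_time := for_time S (for_time S (ctime merge_body)).

Lemma runs_merge_loops :
  runs W (For 5 4 (For 6 4 merge_body)) s0 merge_loops_time (minv (fun _ _ _ => True)).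
Proof.
have [[_ _ _ _ v4] _ _] := consts0.
have hW := room; rewrite /roomy in hW.
have SW : S < W by move: hW; clear; lia.
have sub s : agree (5 :: wvars (For 6 4 merge_body)) (warrs (For 6 4 merge_body)) s0 s ->
    agree loop_vars loop_arrs s0 s.
  by apply: agree_sub; apply/allP.
apply: (runs_weaken (leqnn _) _ (runs_for (N := S)
  (Inv := fun i => minv (fun i' _ _ => i' < i)) _ _ _ _ _)) => //.
- move=> s _; apply: minv_sub => i j cut _ iS jS; by left.
- split=> //=; first by move=> q qK; apply: fresh; move: qK; clear; lia.
  by move=> q qS; rewrite fresh // leq_addr.
move=> i s1 iS v5 /sub ag1 mi1.
have w4 : var s1 4 = S by rewrite ag1.1.
apply: (runs_weaken (leqnn _) _ (runs_for (N := S)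
  (Inv := fun j => minv (fun i' j' _ => i' < i \/ (i' = i /\ j' < j))) _ _ _ _ _)) => //.
- move=> s2 _; apply: minv_sub => i' j' cut; rewrite ltnS leq_eqVlt.
  by case/orP=> [/eqP->|?] _ ?; left; [right|left].
- by apply: minv_sub mi1 => i' j' cut [|[_ //]]; left.
move=> j s2 jS v6 ag2 mi2; apply: runs_wp.
have ag2' : agree loop_vars loop_arrs s0 s2.
  by apply: agree_trans ag1 _; apply: agree_sub ag2; apply/allP.
have w5 : var s2 5 = i by rewrite ag2.1.
apply: wp_conseq (wp_merge_body mi2 ag2' w5 v6 iS jS) => s3.
apply: minv_sub => i' j' cut [h|[-> h]] _ _; left; first by left; left.
by move: h; rewrite ltnS leq_eqVlt => /orP[/eqP->|h]; [right | left; right].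
Qed.

End Body.

Definition merge_time := ctime merge_init + merge_loops_time.

Lemma runs_merge W s (e : 'I_(nE I)) (u v : 'I_n) k1 k2 K :
  roomy I W -> consts I s -> nE I < n ->
  [/\ var s 7 = u, var s 8 = v, var s 10 = K & var s 11 = e] ->
  arr s 7 v = k1 -> arr s 7 u = k2 -> k1 < K -> k2 < K -> K < 2 * n ->
  (forall q, arr s 8 q <= L.+1) -> (forall q, K * S <= q -> arr s 8 q = 0) ->
  runs W merge s merge_time (fun s' =>
    [/\ forall q, q < K * S ->
          [/\ arr s' 8 q = arr s 8 q, arr s' 12 q = arr s 12 q,
              arr s' 13 q = arr s 13 q & arr s' 14 q = arr s 14 q],
        forall q, K.+1 * S <= q -> arr s' 8 q = 0,
        forall q, arr s' 8 q <= L.+1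
      & node_ok (fun i => arr s 8 (k1 * S + i)) (fun i => arr s 8 (k2 * S + i)) e s' K]).
Proof.
move=> room cs ltE [v7 v8 v10 v11] a7v a7u lt1 lt2 ltK low fresh.
have [[v0 v1 v2 v3 v4] ce _] := cs; have [_ _ a2 _] := ce e.
have hW := room; rewrite /roomy in hW; have LS := tabsize_gt I.
have lL : len e <= L by rewrite /total_length (bigD1 e) //= leq_addr.
have b1 : k1 * S <= K * S by rewrite leq_mul2r ltnW ?orbT.
have b2 : k2 * S <= K * S by rewrite leq_mul2r ltnW ?orbT.
have cK := KS_le ltK.
apply: runs_seq; apply: runs_wp.
rewrite /= v7 v8 v10 v11 v4 a7v a7u a2.
have lv := ltn_ord v; have lu := ltn_ord u; have le := ltn_ord e.
do 4 (split; first by move: hW LS lL b1 b2 cK lt1 lt2 ltK ltE lv lu le; clear; lia).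
set s1 := set_var _ _ _ => fr.
have cs1 : consts I s1 := consts_agree fr isT isT cs.
have vs1 : [/\ var s1 11 = e, var s1 12 = k1 * S, var s1 13 = k2 * S,
    var s1 14 = K * S & var s1 15 = len e] by [].
apply: runs_weaken (runs_merge_loops room cs1 vs1 lt1 lt2 ltK low fresh ltE) => //.
move=> s' _ [tb fr' lw so co]; split=> //; split=> // i j cut iS jS; exact: co.
Qed.

End MergeTables.

(** * The elimination loop *)

(* Variable 7 holds the vertex to be examined, 9 the next vertex of the scan
   and 10 the number of the next node; arrays 9, 10 and 11 hold the two
   children and the edge of a node.  A leaf has a single remaining edge, which
   therefore equals the sum of its remaining edges. *)
Definition detach : com :=
  (11 ::= Get 6 (Var 7) ;;
   8 ::= Get 0 (Var 11) + Get 1 (Var 11) - Var 7 ;;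
   5 @[ Var 7 ] ::= Const 0 ;; 6 @[ Var 7 ] ::= Const 0 ;;
   5 @[ Var 8 ] ::= Get 5 (Var 8) - Const 1 ;;
   6 @[ Var 8 ] ::= Get 6 (Var 8) - Var 11 ;;
   9 @[ Var 10 ] ::= Get 7 (Var 8) ;; 10 @[ Var 10 ] ::= Get 7 (Var 7) ;;
   11 @[ Var 10 ] ::= Var 11)%ram.

Definition attach : com :=
  (7 @[ Var 8 ] ::= Var 10 ;; 10 ::= Var 10 + Const 1 ;; 7 ::= Var 8)%ram.

Definition advance : com := (7 ::= Var 9 ;; 9 ::= Var 9 + Const 1)%ram.

Definition elim_body : com :=
  (If (Get 5 (Var 7) == Const 1) (detach ;; merge ;; attach) advance)%ram.

(** The start value [n] is no vertex and has degree 0, so the first round advances to vertex 0. The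
    bound provides for [m] eliminations and [n + 1] advances. *)
Definition elim_init : com :=
  (7 ::= Var 0 ;; 9 ::= Const 0 ;; 10 ::= Var 0 ;;
   20 ::= Var 0 + Var 1 + Const 1)%ram.

Definition elim_loop : com := (elim_init ;; For 21 20 elim_body)%ram.

Section Main.
Variables (I : instance).
Local Notation n := (nV I).
Local Notation m := (nE I).
Local Notation L := (total_length I).
Local Notation S := (tabsize I).
Local Notation V := 'I_(nV I).
Local Notation E := 'I_(nE I).

Definition tab s k q := arr s 8 (k * S + q).

Lemma node_ok_ext T1 T2 T1' T2' (e : E) s s' k :
  (forall i, i < S -> T1' i = T1 i) -> (forall i, i < S -> T2' i = T2 i) ->
  (forall q, q < S -> [/\ arr s' 8 (k * S + q) = arr s 8 (k * S + q),
     arr s' 12 (k * S + q) = arr s 12 (k * S + q),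
     arr s' 13 (k * S + q) = arr s 13 (k * S + q)
   & arr s' 14 (k * S + q) = arr s 14 (k * S + q)]) ->
  node_ok T1 T2 e s k -> node_ok T1' T2' e s' k.
Proof.
move=> h1 h2 hc [so co]; split=> [q qS|i j cut iS jS].
  have [c8 c12 c13 c14] := hc q qS; rewrite c8 /entry_ok c8 c12 c13 c14 => n0.
  have [i [j [cut [a [b1 b2 b3 b4 b5] c d f]]]] := so q qS n0.
  by exists i, j, cut; rewrite !h1 ?h2.
rewrite /covers h1 // h2 // => ce t1 t2 hL cd.
have := co i j cut iS jS ce t1 t2 hL cd.
set q := _ * L.+1 + _; suff qS : q < S by have [-> _ _ _] := hc q qS.
apply: index_lt => //; move: cd; rewrite /cand_c; move: t1 t2; clear; lia.
Qed.

(* [code] witnesses that every node has at most one parent: it maps the left and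
   right child of node [k] to [2 k] and [2 k + 1], and roots to 0. *)
Definition nodes s K (tr : nat -> mtree I) (code : nat -> nat) :=
  [/\ forall v : V, tr v = Leaf v,
      forall k, n <= k < K -> exists e : E,
        [/\ arr s 11 k = e, tr k = Node e (tr (arr s 9 k)) (tr (arr s 10 k)),
            arr s 9 k < k /\ arr s 10 k < k,
            code (arr s 9 k) = 2 * k /\ code (arr s 10 k) = (2 * k).+1
          & node_ok (tab s (arr s 9 k)) (tab s (arr s 10 k)) e s k],
      forall k k', n <= k < K -> n <= k' < K -> arr s 11 k = arr s 11 k' -> k = k',
      forall (v : V) q, q < S -> tab s v q = (q == 0)
    & (forall q, arr s 8 q <= L.+1) /\ (forall q, K * S <= q -> arr s 8 q = 0)].

(** Each round lowers [#|R|] or raises variable 9, whence the equation with [i]. Among the scanned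
    vertices only the current one can be a leaf; since a nonempty [R] has a leaf, none is left once
    the scan has passed all vertices. The newest node is always a root, which identifies the final
    root. *)
Definition elim_inv i s (R : {set E}) A rep (tr : nat -> mtree I) code :=
  [/\ consts I s /\ stars s R,
      forest R A (fun w : V => tr (arr s 7 w)) rep,
      [/\ n <= var s 10, nodes s (var s 10) tr code
        & forall k (f : E), n <= k < var s 10 -> arr s 11 k = f -> f \notin R],
      (forall w : V, w \in A -> arr s 7 w < var s 10 /\ code (arr s 7 w) = 0) /\
      (n < var s 10 -> exists2 w : V, w \in A & arr s 7 w = (var s 10).-1)
    & [/\ var s 10 + #|R| = n + m, var s 9 + m = i + #|R|,
          var s 7 <= n \/ var s 7 < var s 9,
          forall x : V, x < var s 9 -> #|star R x| = 1 -> var s 7 = x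
        & n < var s 9 -> R = set0]].

Lemma forest_ext (R : {set E}) (A : {set V}) tau tau' rep :
  (forall w, w \in A -> tau' w = tau w) -> forest R A tau rep -> forest R A tau' rep.
Proof.
move=> h [f1 f2 f3 f4 f5 f6]; split=> //.
- by move=> w wA; rewrite h ?f2.
- by move=> w wA; rewrite h //; apply: f3.
- by move=> w x wA; rewrite h ?f4.
- by move=> w x wA; rewrite h ?f5.
Qed.

Lemma star_sum1 (R : {set E}) v : \sum_(e in star R v) 1 = #|star R v|.
Proof. by rewrite sum1_card. Qed.

Lemma elim_inv0 s : 0 < n -> consts I s -> stars s [set: E] ->
  (forall v : V, arr s 7 v = v) ->
  (forall q, arr s 8 q = (q < n * S) && (S %| q)) ->
  var s 7 = n -> var s 9 = 0 -> var s 10 = n ->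
  exists R A rep tr code, elim_inv 0 s R A rep tr code.
Proof.
move=> n0 cs st a7 a8 v7 v9 v10.
have trE (v : V) : insubd (Ordinal n0) (v : nat) = v by rewrite valKd.
exists setT, setT, id, (fun k => Leaf (insubd (Ordinal n0) k)), (fun _ => 0).
split=> //.
- by apply: forest_ext (forest0 I) => w _; rewrite a7 trE.
- rewrite v10; split=> //; last by move=> k f; case: ltngtP.
  split.
  + by move=> v; rewrite trE.
  + by move=> k; case: ltngtP.
  + by move=> k k'; case: ltngtP.
  + move=> v q qS; rewrite /tab a8.
    have -> : v * S + q < n * S by move: (ltn_ord v) qS; clear; nia.
    suff -> : (S %| v * S + q) = (q == 0) by [].
    rewrite (dvdn_addr _ (dvdn_mull v (dvdnn S))).
    case: (posnP q) => [->|q0]; first by rewrite dvdn0.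
    by rewrite gtnNdvd //; move: q0; clear; lia.
  + split=> [q|q qS]; first by rewrite a8; case: (_ && _).
    by rewrite a8 ltnNge qS.
- by rewrite v10 ltnn; split=> // w _; rewrite a7.
- rewrite v7 v9 v10 cardsT card_ord; split=> //; first by left.
Qed.

Section Step.
Variables (W i : nat) (s : state) (R : {set E}) (A : {set V}).
Variables (rep : V -> V) (tr : nat -> mtree I) (code : nat -> nat).
Hypothesis tree : is_tree I.
Hypothesis card_I : n = m.+1.
Hypothesis room : roomy I W.
Hypothesis inv : elim_inv i s R A rep tr code.
Hypothesis lti : i < n + m + 1.

Lemma elim_bounds : var s 9 <= n + m + 1 /\ var s 7 <= n + m + 1.
Proof.
have [_ _ _ _ [h1 h2 h3 _ _]] := inv.
have cR : #|R| <= m by rewrite -[X in _ <= X]card_ord; apply: max_card.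
by move: h1 h2 h3 cR lti; clear; lia.
Qed.

Lemma runs_advance : arr s 5 (var s 7) <> 1 ->
  runs W advance s (ctime advance)
    (fun s' => exists R A rep tr code, elim_inv i.+1 s' R A rep tr code).
Proof.
move=> nd; have [[cs st] fo [nK nds eds] al [hK hn hu hl hz]] := inv.
have [sg cg ac] := tree; have [b9 b7] := elim_bounds.
have hW := room; rewrite /roomy in hW.
apply: runs_wp; rewrite /=.
do 2 (split; first by move: hW b9 card_I; clear; lia).
exists R, A, rep, tr, code; split=> //=.
have nl (x : V) : x < var s 9 -> #|star R x| = 1 -> False.
  move=> xn h1; apply: nd; rewrite (hl x xn h1); have [-> _] := st.1 x.
  by rewrite star_sum1.
split=> //.
- by rewrite addn1 !addSn hn.
- by right; rewrite addn1.
- move=> x; rewrite addn1 ltnS leq_eqVlt => /orP[/eqP->//|xn] h1.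
  by case: (nl x xn h1).
- rewrite addn1 ltnS leq_eqVlt => /orP[/eqP n9|]; last exact: hz.
  have [//|R0] := eqVneq R set0; have [x h1] := exists_leaf sg ac R0.
  by case: (nl x _ h1); rewrite -n9.
Qed.

Lemma runs_eliminate : arr s 5 (var s 7) = 1 ->
  runs W (Seq detach (Seq merge attach)) s
    (ctime detach + (merge_time I + ctime attach))
    (fun s' => exists R A rep tr code, elim_inv i.+1 s' R A rep tr code).
Proof.
move=> d1; have [[cs st] fo [nK nds eds] [al _] [hK hn hu hl hz]] := inv.
have [sg cg ac] := tree; have [b9 b7] := elim_bounds.
have hW := room; rewrite /roomy in hW.
have [u uE] : exists u : V, var s 7 = u.
  have un : var s 7 < n by rewrite ltnNge; apply/negP => /st.2; rewrite d1.
  by exists (Ordinal un).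
have [du eu] := st.1 u; rewrite -uE d1 star_sum1 in du.
have /cards1P[e hs] : #|star R u| == 1 by rewrite -du.
rewrite hs big_set1 in eu.
have [v je] := star_joins hs.
have eR : e \in R by move: (set11 e); rewrite -hs inE => /andP[].
have /andP[uA vA] := joins_mem fo eR je.
have uv : (v == u :> nat) = false.
  apply/negP => /eqP/val_inj vu; have := sg.1 e; move: je; rewrite vu /joins.
  by case/orP => /eqP-> /=; rewrite eqxx.
have vu : (u == v :> nat) = false by rewrite eq_sym.
have [[v0 v1 v2 v3 v4] ce _] := cs; have [a0 a1 a2 a3] := ce e.
have vE : arr s 0 e + arr s 1 e - u = v.
  by rewrite a0 a1; case/orP: je => /eqP-> /=; rewrite ?addKn ?addnK.
have sumS (g : E -> nat) x : \sum_(f in star R x) g f =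
    ((x == u) || (x == v)) * g e + \sum_(f in star (R :\ e) x) g f.
  rewrite (sum_star_del g x eR); congr (_ * _ + _).
  by case/orP: je => /eqP-> /=; rewrite !(eq_sym x) // orbC.
have lu := ltn_ord u; have lv := ltn_ord v; have le := ltn_ord e.
have [dv sv] := st.1 v.
have cR : 0 < #|R| by rewrite card_gt0; apply/set0Pn; exists e.
have cD : #|R| = #|R :\ e|.+1 by rewrite (cardsD1 e R) eR.
set K := var s 10 in hK nK nds eds al *.
have ltK : K < 2 * n by move: hK cR card_I; clear; lia.
have [k1K c1] := al v vA; have [k2K c2] := al u uA.
have dvb : arr s 5 v <= m /\ arr s 6 v <= m * m.
  by rewrite dv sv; apply: sum_star_le.
have mm : m * m <= n * n by rewrite card_I; clear; nia.
apply: runs_seq; apply: runs_wp.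
have ea : arr s 0 e <= n /\ arr s 1 e <= n by rewrite a0 a1; split; apply: ltnW.
rewrite /= uE eu vE uv /= -/K.
do 9 (split; first by move: hW card_I lu lv le dvb mm ltK k1K k2K ea; clear; lia).
set s1 := set_arr _ _ _ _ => fr1.
have cs1 : consts I s1 := consts_agree fr1 isT isT cs.
have [tl tn ti tv [low fresh]] := nds.
apply: runs_seq.
have mE : m < n by rewrite card_I.
apply: (runs_weaken (leqnn _) _ (@runs_merge I W s1 e u v (arr s 7 v) (arr s 7 u) K
  room cs1 mE _ _ _ k1K k2K ltK low fresh)) => //.
move=> s2 fr2 [tb2 fresh2 low2 nok2] fr2'.
have cs2 : consts I s2 := consts_agree fr2 isT isT cs1.
have w8 : var s2 8 = v by rewrite fr2.1.
have w10 : var s2 10 = K by rewrite fr2.1.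
apply: runs_wp; rewrite /= w8 w10.
do 3 (split; first by move: hW card_I lv ltK; clear; lia).
set s3 := set_var _ _ _.
set k1 := arr s 7 v in k1K c1 nok2; set k2 := arr s 7 u in k2K c2 nok2.
have root_cur w : w \in A -> troot (tr (arr s 7 w)) = w := fun h => forest_root fo h.
(* Equal nodes would carry the same tree, but the roots [u] and [v] differ. *)
have k12 : (k2 == k1) = false.
  apply/negP => /eqP h; have := root_cur _ uA; rewrite -/k2 h (root_cur _ vA) => h'.
  by rewrite h' eqxx in uv.
have A7 w : arr s3 7 w = if w == v then K else arr s 7 w.
  by rewrite /= (fr2.2 7 isT).
have A9 k : arr s3 9 k = if k == K then k1 else arr s 9 k by rewrite /= (fr2.2 9 isT).
have A10 k : arr s3 10 k = if k == K then k2 else arr s 10 k.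
  by rewrite /= (fr2.2 10 isT).
have A11 k : arr s3 11 k = if k == K then (e : nat) else arr s 11 k.
  by rewrite /= (fr2.2 11 isT).
have T3 k q : k < K -> q < S -> tab s3 k q = tab s k q.
  by move=> kK qS; have [h _ _ _] := tb2 _ (cells_lt kK qS); rewrite /tab /= h.
pose tr' k := if k == K then Node e (tr k1) (tr k2) else tr k.
pose code' k := if k == k1 then 2 * K else if k == k2 then (2 * K).+1 else
  if k == K then 0 else code k.
have trlt k : k < K -> tr' k = tr k by rewrite /tr'; case: ltngtP.
exists (R :\ e), (A :\ u), (fun x => if rep x == u then v else rep x), tr', code'.
split.
- split; first exact: cs2.
  split=> [x|k kn] /=.
    rewrite (fr2.2 5 isT) (fr2.2 6 isT) /= !val_eqE.
    have [dx ex] := st.1 x; move: dx ex; rewrite !sumS.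
    have [->|xv] := eqVneq x v.
      by rewrite orbT => -> ->; rewrite muln1 mul1n !addKn.
    have [->|xu] := eqVneq x u; last by rewrite !mul0n.
    rewrite -uE d1 uE eu muln1 mul1n => h1 h2.
    by split; [apply: (@addnI 1)|apply: (@addnI e)]; rewrite addn0.
  rewrite (fr2.2 5 isT) /=.
  have -> : (k == v) = false by move: kn lv; clear; lia.
  have -> : (k == u) = false by move: kn lu; clear; lia.
  exact: st.2.
- apply: forest_ext (forest_step sg fo hs je) => w; rewrite !inE => /andP[_ wA].
  rewrite A7 val_eqE; case: eqVneq => _; first by rewrite /tr' eqxx.
  by rewrite trlt //; case: (al w wA).
- have -> : var s3 10 = K.+1 by rewrite /= addn1.
  have eds' k (f : E) : n <= k < K.+1 -> arr s3 11 k = f -> f \notin R :\ e.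
    move=> /andP[nk]; rewrite ltnS leq_eqVlt A11 => /orP[/eqP->|kK].
      by rewrite eqxx => /val_inj->; rewrite !inE eqxx.
    rewrite (ltn_eqF kK) => h; have := eds k f _ h; rewrite nk kK => /(_ isT).
    by rewrite !inE negb_and => ->; rewrite orbT.
  split=> //; first exact: leqW.
  split=> //.
  + by move=> x; rewrite trlt ?tl //; apply: leq_trans nK.
  + move=> k /andP[nk]; rewrite ltnS leq_eqVlt => /orP[/eqP->|kK].
      exists e; rewrite A9 A10 A11 !eqxx; split=> //.
      * by rewrite /tr' eqxx (ltn_eqF k1K) (ltn_eqF k2K).
      * by rewrite /code' eqxx k12 eqxx.
      * by apply: node_ok_ext nok2 => // q qS; rewrite T3.
    have kK' := ltn_eqF kK.
    have [|f [f1 f2 [f3 f3'] [f4 f4'] f5]] := tn k; first by rewrite nk.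
    have k0 : 0 < k by apply: leq_trans nk; rewrite card_I.
    (* Children of older nodes have nonzero codes, while [k1] and [k2] were roots with code 0: no
       node acquires a second parent. *)
    have nc a : code a != 0 -> a < K -> code' a = code a.
      move=> ca aK; rewrite /code' (ltn_eqF aK).
      have [aE|_] := eqVneq a k1; first by rewrite aE c1 in ca.
      by have [aE|//] := eqVneq a k2; rewrite aE c2 in ca.
    have l9 : arr s 9 k < K by apply: ltn_trans kK.
    have l10 : arr s 10 k < K by apply: ltn_trans kK.
    exists f; rewrite A9 A10 A11 kK'; split=> //.
    * by rewrite !trlt.
    * by rewrite !nc // ?f4 ?f4' //; move: k0; clear; lia.
    * apply: node_ok_ext f5 => [q qS|q qS|q qS]; rewrite ?T3 //.
      by apply: tb2 (cells_lt kK qS).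
  + have nE k : n <= k < K -> arr s 11 k <> e.
      by move=> nk h; have := eds k e nk h; rewrite eR.
    move=> k k' /andP[nk]; rewrite ltnS leq_eqVlt !A11 => /orP[/eqP->|kK];
      move=> /andP[nk']; rewrite ltnS leq_eqVlt => /orP[/eqP->|kK'] //.
    * by rewrite eqxx (ltn_eqF kK') => /esym h; case: (nE k'); rewrite ?nk'.
    * by rewrite eqxx (ltn_eqF kK) => h; case: (nE k); rewrite ?nk.
    * by rewrite (ltn_eqF kK) (ltn_eqF kK'); apply: ti; rewrite ?nk ?nk'.
  + by move=> x q qS; rewrite T3 ?tv //; apply: leq_trans nK.
- split; last first.
    by exists v; [rewrite !inE vA andbT; apply/eqP => h; rewrite h eqxx in uv
      | rewrite A7 eqxx /= addn1].
  move=> w; rewrite !inE => /andP[wu wA]; rewrite A7 /= addn1 val_eqE.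
  have [_|wv] := eqVneq w v.
    by split=> //; rewrite /code' (gtn_eqF k1K) (gtn_eqF k2K) eqxx.
  have [cK c0] := al w wA; split; first exact: ltnW.
  rewrite /code' (ltn_eqF cK).
  have -> : (arr s 7 w == k1) = false.
    apply/negP => /eqP h; have := root_cur _ wA; rewrite h (root_cur _ vA) => h'.
    by rewrite h' eqxx in wv.
  suff -> : (arr s 7 w == k2) = false by [].
  apply/negP => /eqP h; have := root_cur _ wA; rewrite h (root_cur _ uA) => h'.
  by rewrite h' eqxx in wu.
- rewrite /= (fr2.1 9 isT) /=; split.
  + by rewrite addn1 addSnnS -cD.
  + by rewrite hn cD addSnnS.
  + by left; apply: ltnW.
  (* Only [v] can have become a leaf: [u] has lost its last edge and all other degrees are
     unchanged. Moving on to [v] therefore leaves no scanned leaf behind. *)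
  + move=> x xn h1; congr (nat_of_ord _); apply/eqP; rewrite eq_sym; apply: contraTT (eqxx 0).
    move=> xv; have := sumS (fun _ => 1) x; rewrite !star_sum1 h1 (negPf xv) orbF muln1.
    have [xu|xu] := eqVneq x u; first by rewrite xu hs cards1.
    rewrite add0n => h1'; have := hl x xn h1'; rewrite uE => /val_inj h'.
    by rewrite h' eqxx in xu.
  + by move=> /hz R0; rewrite R0 inE in eR.
Qed.

End Step.

Definition elim_body_time :=
  (expr_time (Get 5 (Var 7) == Const 1)%ram +
   (ctime detach + (merge_time I + ctime attach) + ctime advance)).+1.

Definition elim_time := ctime elim_init + for_time (n + m + 1) elim_body_time.

Lemma elim_inv_final s R A rep tr code : connected_graph I -> n = m.+1 ->
  elim_inv (n + m + 1) s R A rep tr code ->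
  [/\ consts I s, nodes s (n + m) tr code /\ var s 10 = n + m, wf (tr (n + m).-1),
      forall x, x \in verts (tr (n + m).-1)
    & forall e, e \in edges (tr (n + m).-1)].
Proof.
move=> cg card_I [[cs _] fo [_ nds _] [al last] [hK hn _ _ hz]].
(* After [n + m + 1] rounds the count gives [var s 9 = n + 1 + #|R|], beyond the last vertex. *)
have R0 : R = set0.
  apply: hz; rewrite -(ltn_add2r m) hn; apply: leq_trans (leq_addr _ _).
  by rewrite addn1.
rewrite R0 cards0 addn0 in hK; rewrite R0 in fo; rewrite hK in nds al last.
have [r [rA Ar wt hV hE]] := forest_final cg fo.
have er : arr s 7 r = (n + m).-1.
  (* Without edges no inner node was created, and the root is the single vertex 0. *)
  have [n1|m0] := posnP m; last first.
    by have [|w wA <-] := last; [rewrite -addn1 leq_add2l | rewrite -(Ar w wA)].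
  have [h _] := al r rA; move: (arr s 7 r) h card_I n1; clear; lia.
by rewrite -er; split.
Qed.

Lemma runs_elim_loop W s : is_tree I -> roomy I W ->
  consts I s -> stars s [set: E] ->
  (forall v : V, arr s 7 v = v) ->
  (forall q, arr s 8 q = (q < n * S) && (S %| q)) ->
  runs W elim_loop s elim_time (fun s' => exists tr code,
    [/\ consts I s', nodes s' (n + m) tr code /\ var s' 10 = n + m, wf (tr (n + m).-1),
        forall x, x \in verts (tr (n + m).-1)
      & forall e, e \in edges (tr (n + m).-1)]).
Proof.
move=> tree room cs st a7 a8; have card_I := tree_card tree.
have [sg cg ac] := tree.
have [[v0 v1 _ _ _] _ _] := cs; have hW := room; rewrite /roomy in hW.
apply: runs_seq; apply: runs_wp; rewrite /= v0 v1.
do 4 (split; first by move: hW card_I; clear; lia).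
set s1 := set_var _ _ _ => _.
apply: (runs_weaken (leqnn _) _ (runs_for (N := n + m + 1) (Inv := fun i s =>
  exists R A rep tr code, elim_inv i s R A rep tr code) _ _ _ _ _)) => //.
- move=> s' _ [R [A [rep [tr [code inv]]]]]; exists tr, code.
  exact: elim_inv_final inv.
- by move: hW card_I; clear; lia.
- by apply: elim_inv0 => //; case: cg.
move=> i s2 iN _ _ [R [A [rep [tr [code inv]]]]].
have [b9 b7] := elim_bounds inv iN.
have [[_ [st2 st2']] _ _ _ _] := inv.
have d5 : arr s2 5 (var s2 7) <= m.
  case: (ltnP (var s2 7) n) => [un|/st2'->//].
  have [-> _] := st2 (Ordinal un); exact: (sum_star_le R (Ordinal un)).1.
apply: runs_weaken (runs_if (e := (Get 5 (Var 7) == Const 1)%ram) _ _ _);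
  [exact: leqnn | move=> s' _ H; exact: H | | | ].
- by rewrite /=; move: hW card_I b7 d5; clear; lia.
- rewrite [eval _ _]/= eqb0 negbK => /eqP d1.
  apply: runs_weaken (leq_addr _ _) _ (runs_eliminate tree card_I room inv iN d1) => //.
- rewrite [eval _ _]/= => /eqP; rewrite eqb0 => /eqP nd.
  apply: runs_weaken (leq_addl _ _) _ (runs_advance tree card_I room inv iN nd) => //.
Qed.

End Main.

(** * Reading off an optimal set *)

(* Variables 22 and 23 hold the least value found in the table of the root and
   its index; array 15 holds the table index selected at a node. *)
Definition best_init : com :=
  (12 ::= (Var 10 - Const 1) * Var 4 ;; 22 ::= Var 3 + Var 3)%ram.

Definition best_body : com :=
  (If (Get 8 (Var 12 + Var 5))
     (If (Get 8 (Var 12 + Var 5) + Get 17 (Var 5) <= Var 22)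
        (22 ::= Get 8 (Var 12 + Var 5) + Get 17 (Var 5) ;; 23 ::= Var 5) Skip)
     Skip)%ram.

Definition select_root : com := (15 @[ Var 10 - Const 1 ] ::= Var 23)%ram.

Definition back_body : com :=
  (24 ::= Var 10 - Const 1 - Var 5 ;;
   25 ::= Var 24 * Var 4 + Get 15 (Var 24) ;;
   If (Get 8 (Var 25))
     (15 @[ Get 9 (Var 24) ] ::= Get 12 (Var 25) ;;
      15 @[ Get 10 (Var 24) ] ::= Get 13 (Var 25) ;;
      4 @[ Get 11 (Var 24) ] ::= Get 14 (Var 25))
     Skip)%ram.

Definition finish : com :=
  ((best_init ;; For 5 4 best_body) ;; select_root ;; For 5 1 back_body)%ram.

Definition solver : com := (setup ;; elim_loop ;; finish)%ram.

Section Finish.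
Variables (I : instance).
Local Notation n := (nV I).
Local Notation m := (nE I).
Local Notation L := (total_length I).
Local Notation S := (tabsize I).
Local Notation V := 'I_(nV I).
Local Notation E := 'I_(nE I).

(** The condition allows a proof at every inner node before it is known that the selected entries
    are nonempty; nonemptiness spreads from the root in [traced_sound]. *)
Definition traced s k :=
  tab I s k (arr s 15 k) != 0 ->
  [/\ arr s 15 (arr s 9 k) = arr s 12 (k * S + arr s 15 k),
      arr s 15 (arr s 10 k) = arr s 13 (k * S + arr s 15 k)
    & arr s 4 (arr s 11 k) = arr s 14 (k * S + arr s 15 k)].

Lemma hof0 : hof I 0 = 0. Proof. exact: div0n. Qed.
Lemma dof0 : dof I 0 = 0. Proof. exact: mod0n. Qed.

(** Strong induction, as children have smaller numbers: the pointers of a nonempty entry lead to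
    nonempty entries, and the output realises exactly the height, diameter and cost that the
    selected entry promises. *)
Lemma traced_sound s tr code k : nodes s (n + m) tr code ->
  (forall k, arr s 15 k < S) -> (forall k, n <= k < n + m -> traced s k) ->
  k < n + m -> tab I s k (arr s 15 k) != 0 ->
  [/\ ht (output I s) (tr k) = hof I (arr s 15 k),
      dm (output I s) (tr k) = dof I (arr s 15 k),
      (oc (output I s) (tr k)).+1 = tab I s k (arr s 15 k)
    & forall e, e \in edges (tr k) -> e \in output I s -> e \in E0 I].
Proof.
move=> [tl tn _ tv _] wS trc; have [K] := ubnP k; elim: K k => // K IH k.
rewrite ltnS => kK km n0.
have [kn|kn] := ltnP k n.
  have Ek : tr k = Leaf (Ordinal kn) := tl (Ordinal kn).
  have Et := tv (Ordinal kn) _ (wS k); rewrite /= in Et.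
  move: n0; rewrite Ek Et eqb0 negbK => /eqP->.
  by split; rewrite ?hof0 ?dof0.
have nk : n <= k < n + m by rewrite kn.
have [e [a11 trE [l9 l10] _ [so _]]] := tn k nk.
have [w9 w10 w4] := trc k nk n0.
have [i [j [cut [[b12 b13 b14] [iS jS t1 t2 ce] hE dE cE]]]] := so _ (wS k) n0.
rewrite b12 in w9; rewrite b13 in w10; rewrite b14 a11 in w4.
have k9K := leq_trans l9 kK; have k10K := leq_trans l10 kK.
have k9m := ltn_trans l9 km; have k10m := ltn_trans l10 km.
have [|h1 d1 o1 f1] := IH _ k9K k9m; first by rewrite w9.
have [|h2 d2 o2 f2] := IH _ k10K k10m; first by rewrite w10.
have eF : (e \in output I s) = cut by rewrite inE w4 eqb0 negbK.
rewrite trE /= eF h1 h2 d1 d2 w9 w10 -hE -dE; split=> //.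
  rewrite /tab in cE *; rewrite cE /cand_c /oc_merge; move: o1 o2.
  by rewrite /tab w9 w10 => <- <-; case: (cut); lia.
move=> f; rewrite inE mem_cat => /or3P[/eqP->|/f1//|/f2//].
by rewrite eF => c; move: ce; rewrite c.
Qed.

(** The entries of the children at the exact heights and diameters induced by [F] combine, with the
    decision of [F] on the edge, to the index induced by [F] at the node. The candidate passes the
    size test by [dm_oc_total]. *)
Lemma nodes_complete s tr code (F : {set E}) k : nodes s (n + m) tr code ->
  F \subset E0 I -> k < n + m -> wf (tr k) ->
  0 < tab I s k (ht F (tr k) * L.+1 + dm F (tr k)) <= (oc F (tr k)).+1.
Proof.
move=> [tl tn _ tv _] FE; have [K] := ubnP k; elim: K k => // K IH k.
rewrite ltnS => kK km wk.
have [kn|kn] := ltnP k n.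
  have -> : tr k = Leaf (Ordinal kn) := tl (Ordinal kn).
  by have := tv (Ordinal kn) 0 isT; rewrite /= mul0n => ->.
have nk : n <= k < n + m by rewrite kn.
have [e [_ trE [l9 l10] _ [_ co]]] := tn k nk.
have LF t : wf t -> ht F t <= L /\ dm F t <= L.
  move=> wt; have := dm_oc_total F wt; have := ht_le_dm F t; clear; lia.
have bnd := dm_oc_total F wk; have hd := ht_le_dm F (tr k).
move: wk bnd hd; rewrite trE => -[je dj w1 w2] bnd hd.
have [hL1 dL1] := LF _ w1; have [hL2 dL2] := LF _ w2.
have k9K := leq_trans l9 kK; have k10K := leq_trans l10 kK.
have /andP[p1 q1] := IH _ k9K (ltn_trans l9 km) w1.
have /andP[p2 q2] := IH _ k10K (ltn_trans l10 km) w2.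
have := co _ _ (e \in F) (index_lt (I := I) hL1 dL1) (index_lt (I := I) hL2 dL2).
rewrite /covers /cand_h /cand_d /cand_c !hof_index // !dof_index // -!lt0n => h.
have eE : (e \in F) ==> (e \in E0 I) by apply/implyP => /(subsetP FE).
have {h} := h eE p1 p2.
rewrite -[ht_merge _ _ _ _]/(ht F (Node e (tr (arr s 9 k)) (tr (arr s 10 k)))).
rewrite -[dm_merge _ _ _ _ _ _]/(dm F (Node e (tr (arr s 9 k)) (tr (arr s 10 k)))).
set c := _ + _ - 1 + _ => h.
have cb : c <= (oc F (Node e (tr (arr s 9 k)) (tr (arr s 10 k)))).+1.
  rewrite /c /= /oc_merge; move: p1 p2 q1 q2; clear; lia.
have hL : ht F (Node e (tr (arr s 9 k)) (tr (arr s 10 k))) <= L.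
  by move: bnd hd; clear; lia.
have hc : c + dm F (Node e (tr (arr s 9 k)) (tr (arr s 10 k))) <= L.+1.
  by move: bnd cb; clear; lia.
have /andP[p h2] := h hL hc; rewrite {1}/tab p /=; exact: leq_trans h2 cb.
Qed.


Definition finish_time :=
  ctime best_init + for_time S (ctime best_body) +
    (ctime select_root + for_time m (ctime back_body)).

Lemma runs_best W s (tr : nat -> mtree I) code : roomy I W -> n = m.+1 -> consts I s ->
  nodes s (n + m) tr code -> var s 10 = n + m ->
  (exists2 q, q < S & tab I s (n + m).-1 q != 0) ->
  runs W (Seq best_init (For 5 4 best_body)) s
    (ctime best_init + for_time S (ctime best_body))
    (fun s' => [/\ var s' 23 < S, tab I s' (n + m).-1 (var s' 23) != 0
      & forall q, q < S -> tab I s' (n + m).-1 q != 0 ->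
          tab I s' (n + m).-1 (var s' 23) + dof I (var s' 23) <=
          tab I s' (n + m).-1 q + dof I q]).
Proof.
move=> room card_I cs [_ _ _ _ [low _]] v10 [q0 q0S q0n].
have [[v0 v1 v2 v3 v4] _ cq] := cs; have hW := room; rewrite /roomy in hW.
have LS := tabsize_gt I; have lowT q : tab I s (n + m).-1 q <= L.+1 by apply: low.
have kS : (n + m).-1 * S <= 2 * (n * S).
  rewrite mulnA leq_mul2r; apply/orP; right; move: card_I; clear; lia.
apply: runs_seq; apply: runs_wp; rewrite /= v10 v3 v4 subn1.
do 2 (split; first by move: hW LS kS card_I; clear; lia).
set s1 := set_var _ _ _ => _.
set T := tab I s (n + m).-1.
apply: (runs_weaken (leqnn _) _ (runs_for (N := S) (Inv := fun i s' =>
  [/\ var s' 22 <= L.+1 + L.+1, forall q, q < i -> T q != 0 -> var s' 22 <= T q + dof I q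
    & (forall q, q < i -> T q = 0) /\ var s' 22 = L.+1 + L.+1 \/
      [/\ var s' 23 < S, T (var s' 23) != 0 & var s' 22 = T (var s' 23) + dof I (var s' 23)]])
  _ _ _ _ _)) => //.
- move=> s' fr [_ le [[z _]|[lt n0 E]]].
    by move: q0n; rewrite -/T z.
  have TE q : tab I s' (n + m).-1 q = T q by rewrite /tab (fr.2 8 isT).
  rewrite TE; split=> // q qS; rewrite TE => qn; rewrite -E; exact: le.
- by move: hW; clear; lia.
- by split=> //; left.
move=> i s2 iS v5 [av aa] [b22 le dis]; apply: runs_wp.
have w12 : var s2 12 = (n + m).-1 * S by rewrite av.
have a8 : arr s2 8 ((n + m).-1 * S + i) = T i by rewrite aa.
have a17 : arr s2 17 i = dof I i by rewrite aa //=; have [_ ->] := cq i iS.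
have dL := dof_lt I i; have Ti := lowT i; rewrite -/T in Ti.
rewrite /= v5 w12 a8 a17.
split; first by move: hW LS kS iS Ti; clear; lia.
  move=> Tn; split; first by move: hW LS kS iS Ti dL b22; clear; lia.
    rewrite eqb0 negbK => h.
    do 2 (split; first by move: hW LS kS iS Ti dL; clear; lia).
    split.
    - by move: Ti dL; clear; lia.
    - move=> q; rewrite ltnS leq_eqVlt => /orP[/eqP->//|qi] qn.
      exact: leq_trans h (le q qi qn).
    - by right.
  move/eqP; rewrite eqb0 -ltnNge => h; split=> //.
    move=> q; rewrite ltnS leq_eqVlt => /orP[/eqP->|qi] qn; last exact: le.
    exact: ltnW.
  (* The initial value [2 * M] exceeds every value plus diameter, so the first nonempty entry is
     accepted. *)
  case: dis => [[_ z]|]; last by right.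
  by move: h z Ti dL; clear; lia.
move=> Tz; split=> //.
  move=> q; rewrite ltnS leq_eqVlt => /orP[/eqP->|qi]; last exact: le.
  by rewrite Tz.
case: dis => [[z e22]|]; last by right.
by left; split=> // q; rewrite ltnS leq_eqVlt => /orP[/eqP->//|/z].
Qed.

Lemma nodes_agree xs bs s s' K (tr : nat -> mtree I) code :
  agree xs bs s s' -> all (fun a => a \notin bs) (iota 8 7) ->
  nodes s K tr code -> nodes s' K tr code.
Proof.
move=> [_ ag] /allP hb; have eqa a : a \in iota 8 7 -> arr s' a =1 arr s a.
  by move=> /hb; apply: ag.
move=> [tl tn ti tv [low fresh]]; split=> //.
- move=> k nk; have [e [h1 h2 h3 h4 h5]] := tn k nk; exists e.
  rewrite !(eqa 9, eqa 10, eqa 11) //; split=> //.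
  by apply: node_ok_ext h5 => q qS; rewrite /tab ?(eqa 8) // !eqa.
- by move=> k k' nk nk'; rewrite !(eqa 11) //; apply: ti.
- by move=> v q qS; rewrite /tab (eqa 8) //; apply: tv.
- by split=> q; rewrite (eqa 8) //; apply: fresh.
Qed.

(** Nodes are visited in decreasing order, hence after their parents, and a visit writes only
    selections of smaller nodes. As nodes have one parent and edges one node, it does not disturb
    what earlier visits wrote. *)
Lemma runs_back W s (tr : nat -> mtree I) code : roomy I W -> n = m.+1 ->
  consts I s -> nodes s (n + m) tr code -> var s 10 = n + m ->
  (forall k, arr s 15 k < S) ->
  runs W (For 5 1 back_body) s (for_time m (ctime back_body))
    (fun s' => [/\ forall k, arr s' 15 k < S,
        arr s' 15 (n + m).-1 = arr s 15 (n + m).-1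
      & forall k, n <= k < n + m -> traced s' k]).
Proof.
move=> room card_I cs nds v10 wS.
have [[v0 v1 v2 v3 v4] _ _] := cs; have hW := room; rewrite /roomy in hW.
have LS := tabsize_gt I.
have [tl tn ti tv [low fresh]] := nds.
apply: (runs_weaken (leqnn _) _ (runs_for (N := m) (Inv := fun i s' =>
  [/\ forall k, arr s' 15 k < S, arr s' 15 (n + m).-1 = arr s 15 (n + m).-1
    & forall k, n + m - i <= k < n + m -> traced s' k]) _ _ _ _ _)) => //.
- move=> s' _ [h1 h2 h3]; split=> // k /andP[nk km].
  by apply: h3; rewrite addnK nk.
- by move: hW card_I; clear; lia.
- split=> // k; rewrite subn0 => /andP[h1 h2].
  by move: (leq_ltn_trans h1 h2); rewrite ltnn.
move=> i s1 im v5 [av aa] [wS1 root1 trc]; apply: runs_wp.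
set k0 := n + m - 1 - i.
have nk0 : n <= k0 < n + m by rewrite /k0; move: im card_I; clear; lia.
have [e [a11 _ [l9 l10] [c9 c10] nok]] := tn k0 nk0.
have w10 : var s1 10 = n + m by rewrite av.
have w4 : var s1 4 = S by rewrite av.
set q := arr s1 15 k0; have qS : q < S := wS1 k0.
have cell : k0 * S + q < 2 * (n * S).
  apply: leq_trans (cells_lt (K := n + m) (andP nk0).2 qS) _.
  by rewrite mulnA leq_mul2r; apply/orP; right; move: card_I; clear; lia.
rewrite /= w10 w4 v5 -/k0 -/q.
have k0m : k0 < n + m by case/andP: nk0.
have cell' : k0 * S <= k0 * S + q by apply: leq_addr.
split; first by move: hW im card_I; rewrite /k0; clear; lia.
split; first by move: hW card_I k0m cell cell' qS LS; clear; lia.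
have T1 : arr s1 8 (k0 * S + q) = tab I s k0 q by rewrite aa.
have lowq : tab I s k0 q <= L.+1 by apply: low.
rewrite T1.
split; first by move: hW cell lowq LS; clear; lia.
- move=> tn0; have [so _] := nok.
  have [i1 [j1 [cut [[b12 b13 b14] [iS jS _ _ _] _ _ _]]]] := so q qS tn0.
  have A9 k : arr s1 9 k = arr s 9 k by rewrite aa.
  have A10 k : arr s1 10 k = arr s 10 k by rewrite aa.
  have A11 k : arr s1 11 k = arr s 11 k by rewrite aa.
  have B12 k : arr s1 12 k = arr s 12 k by rewrite aa.
  have B13 k : arr s1 13 k = arr s 13 k by rewrite aa.
  have B14 k : arr s1 14 k = arr s 14 k by rewrite aa.
  have lr : (arr s 9 k0 == arr s 10 k0) = false.
    by apply/negP => /eqP h; move: c9; rewrite h c10; clear; lia.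
  rewrite A9 A10 A11 B12 B13 B14 b12 b13 b14 a11.
  have le := ltn_ord e; have cb : nat_of_bool cut <= 1 by case: (cut).
  do 3 (split; first by move: hW card_I cell iS jS l9 l10 k0m le cb LS; clear; lia).
  split=> [k||k /andP[k0k km]] /=.
  + by case: eqP => _ //; case: eqP.
  + have lt : k0 <= (n + m).-1 by rewrite -ltnS prednK // card_I.
    by rewrite !gtn_eqF ?root1 //; apply: leq_trans lt.
  + have le0 : k0 <= k by rewrite /k0; move: k0k; clear; lia.
    have nk : n <= k < n + m by rewrite km andbT; case/andP: nk0 => /leq_trans->.
    have [f [g11 _ _ [d9 d10] _]] := tn k nk.
    rewrite /traced /tab /= !(gtn_eqF (leq_trans l9 le0)) !(gtn_eqF (leq_trans l10 le0)).
    rewrite !(A9, A10, A11, B12, B13, B14).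
    have [ek|nek] := eqVneq k k0.
      by rewrite ek -/q T1 a11 !eqxx lr b12 b13 b14.
    (* The parity of a code tells left from right children and its half names the parent, so the
       children of [k] and [k0] are distinct. *)
    have n1 : (arr s 9 k == arr s 10 k0) = false.
      by apply/negP => /eqP h; move: d9; rewrite h c10; clear; lia.
    have n2 : (arr s 9 k == arr s 9 k0) = false.
      by apply/negP => /eqP h; move: d9 nek; rewrite h c9; clear; lia.
    have n3 : (arr s 10 k == arr s 10 k0) = false.
      by apply/negP => /eqP h; move: d10 nek; rewrite h c10; clear; lia.
    have n4 : (arr s 10 k == arr s 9 k0) = false.
      by apply/negP => /eqP h; move: d10; rewrite h c9; clear; lia.
    have n5 : (arr s 11 k == e) = false.
      by apply/negP => /eqP h; case/eqP: nek; apply: ti; rewrite ?h.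
    rewrite n1 n2 n3 n4 n5.
    have := trc k; rewrite /traced /tab !(A9, A10, A11, B12, B13, B14); apply.
    by rewrite km andbT; move: le0 nek k0k; rewrite /k0; clear; lia.
- move=> tz; split=> // k /andP[k0k km].
  have [ek|nek] := eqVneq k k0.
    by rewrite ek /traced /tab /= -/q T1 tz.
  apply: trc; rewrite km andbT; move: nek k0k; rewrite /k0; clear; lia.
Qed.

Lemma runs_finish W s (tr : nat -> mtree I) code :
  is_tree I -> roomy I W -> consts I s -> nodes s (n + m) tr code ->
  var s 10 = n + m -> (forall k, arr s 15 k = 0) -> wf (tr (n + m).-1) ->
  (forall x, x \in verts (tr (n + m).-1)) ->
  (forall e, e \in edges (tr (n + m).-1)) ->
  runs W finish s finish_time (fun s' => optimal (output I s')).
Proof.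
move=> tree room cs nds v10 a15 wt hV hE; have card_I := tree_card tree.
have [sg cg ac] := tree; have hW := room; rewrite /roomy in hW.
set K := (n + m).-1 in wt hV hE *.
have Km : K < n + m by rewrite /K card_I.
have LF F : ht F (tr K) <= L /\ dm F (tr K) <= L.
  by have := dm_oc_total F wt; have := ht_le_dm F (tr K); clear; lia.
have iS F : ht F (tr K) * L.+1 + dm F (tr K) < S.
  by have [h1 h2] := LF F; apply: index_lt.
have cm (F : {set E}) (h : F \subset E0 I) := nodes_complete nds h Km wt.
apply: runs_seq.
apply: (runs_weaken (leqnn _) _ (runs_best room card_I cs nds v10 _)) => //; last first.
  (* Removing nothing is always admissible, so the table of the root is not empty. *)
  exists (ht set0 (tr K) * L.+1 + dm set0 (tr K)); first exact: iS.
  by have /andP[h _] := cm set0 (sub0set _); rewrite -lt0n.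
move=> s1 fr1 [qS qn qmin] _.
have cs1 := consts_agree fr1 isT isT cs.
have nds1 := nodes_agree fr1 isT nds.
have w10 : var s1 10 = n + m by rewrite fr1.1.
apply: runs_seq; apply: runs_wp; rewrite /= w10 subn1 -/K.
have KS : K <= 2 * n by rewrite /K; move: card_I; clear; lia.
split; first by move: hW KS qS card_I; clear; lia.
set s2 := set_arr _ _ _ _ => fr2.
have cs2 := consts_agree fr2 isT isT cs1.
have nds2 := nodes_agree fr2 isT nds1.
have a15' k : arr s2 15 k < S.
  by rewrite /=; case: eqP => // _; rewrite (fr1.2 15 isT) a15.
apply: runs_weaken (leqnn _) _ (runs_back room card_I cs2 nds2 w10 a15').
move=> s3 fr3 [b15 root3 trc].
have nds3 := nodes_agree fr3 isT nds2.
have root3' : arr s3 15 K = var s1 23 by rewrite root3 /= -/K eqxx.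
have TE q : tab I s3 K q = tab I s1 K q by rewrite /tab (fr3.2 8 isT).
have [|h3 d3 o3 f3] := traced_sound nds3 b15 trc Km; first by rewrite root3' TE.
split; first by apply/subsetP => e; apply: f3.
move=> F' F'E; rewrite !(cost_mtree _ sg cg wt hV hE).
have /andP[p1 p2] := cm F' F'E; have [h1 h2] := LF F'.
have TE1 q : tab I s1 K q = tab I s K q by rewrite /tab (fr1.2 8 isT).
(* The entry indexed by [F'] has value plus diameter at most one more than the cost of [F']; the
   selected entry minimises this sum, and for it the sum is one more than the cost of the output. *)
have := qmin _ (iS F'); rewrite -/K !TE1 -lt0n => /(_ p1).
rewrite dof_index //; move: o3; rewrite d3 root3' TE TE1.
by move: p2; clear; lia.
Qed.

Definition solver_time := setup_time I + (elim_time I + finish_time).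

Lemma runs_solver W : is_tree I -> roomy I W ->
  runs W solver (input I) solver_time (fun s => optimal (output I s)).
Proof.
move=> tree room; have [sg _ _] := tree; have card_I := tree_card tree.
apply: runs_seq; apply: runs_weaken (leqnn _) _ (runs_setup sg card_I room).
move=> s1 fr1 [cs1 st1 a7 a8] _.
apply: runs_seq; apply: runs_weaken (leqnn _) _ (runs_elim_loop tree room cs1 st1 a7 a8).
move=> s2 fr2 [tr [code [cs2 [nds v10] wt hV hE]]] _.
apply: (runs_finish tree room cs2 nds v10 _ wt hV hE).
by move=> k; rewrite (fr2.2 15 isT) (fr1.2 15 isT).
Qed.

End Finish.

(** * Running time and word size *)

Lemma for_time_le N T a x y : N <= y -> T <= a * x -> 0 < x -> 0 < y ->
  for_time N T <= (a + 20) * (y * x).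
Proof. by rewrite /for_time => *; nia. Qed.

(** One summand per phase, each a multiple of [n * (S * S)]. A loop adds 20 to the constant of its
    body, two nested loops add 40; the factor 2 comes from [n + m + 1 <= 2 * n]. *)
Definition solver_const :=
  (ctime scan_edge + 20) + ctime init_scalars + (ctime init_index + 20) +
  (ctime init_vertex + 20) +
  ctime elim_init +
  2 * (expr_time (Get 5 (Var 7) == Const 1)%ram + ctime detach + ctime attach +
    ctime advance + 1 + ctime merge_init + (ctime merge_body + 40) + 20) +
  ctime best_init + (ctime best_body + 20) + ctime select_root +
  (ctime back_body + 20).

Lemma solver_time_le (I : instance) : nV I = (nE I).+1 ->
  solver_time I <= 16 * solver_const * (nV I * maxn 1 (total_length I) ^ 4).
Proof.
move=> card_I.
set n := nV I in card_I *; set m := nE I in card_I *; set S := tabsize I.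
have S1 : 0 < S by [].
have n1 : 0 < n by rewrite card_I.
have mn : m <= n by rewrite card_I.
have Q1 : 0 < S * S by rewrite muln_gt0 S1.
(* Here [S * S] is the fourth power of [L + 1], and [L + 1] is at most twice [maxn 1 L], whence the
   factor 16. *)
have YS : S * S <= 16 * maxn 1 (total_length I) ^ 4.
  have h : (total_length I).+1 <= 2 * maxn 1 (total_length I) by clear; lia.
  apply: leq_trans (leq_mul (leq_mul h h) (leq_mul h h)) _.
  by move: (maxn _ _) => Y; rewrite !expnS expn0; clear; nia.
suff h : solver_time I <= solver_const * (n * (S * S)).
  apply: leq_trans h _; rewrite (mulnC 16) -mulnA leq_mul2l; apply/orP; right.
  by rewrite [X in _ <= X]mulnCA leq_mul2l YS orbT.
have up a : a <= a * (n * (S * S)) by rewrite leq_pmulr // muln_gt0 n1.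
have upS : S * 1 <= n * (S * S) by rewrite mulnC leq_mul // leq_pmulr.
have f1 a : for_time m a <= (a + 20) * (n * (S * S)).
  apply: leq_trans (for_time_le (a := a) (x := 1) mn _ _ n1) _; rewrite ?muln1 //.
  by rewrite leq_mul // leq_pmulr.
have f2 a : for_time n a <= (a + 20) * (n * (S * S)).
  apply: leq_trans (for_time_le (a := a) (x := 1) (leqnn n) _ _ n1) _; rewrite ?muln1 //.
  by rewrite leq_mul // leq_pmulr.
have f3 a : for_time S a <= (a + 20) * (n * (S * S)).
  apply: leq_trans (for_time_le (a := a) (x := 1) (leqnn S) _ _ S1) _; rewrite ?muln1 //.
  by rewrite leq_mul //; move: upS; rewrite muln1.
have f4 a : for_time S (for_time S a) <= (a + 40) * (S * S).
  have h : for_time S a <= (a + 20) * S.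
    by rewrite -[X in _ * X]muln1; apply: for_time_le; rewrite ?muln1.
  by apply: leq_trans (for_time_le (leqnn S) h S1 S1) _; rewrite -addnA.
have f5 a b : a <= b * (S * S) -> for_time (n + m + 1) a <= (2 * (b + 20)) * (n * (S * S)).
  move=> h; have nm : n + m + 1 <= 2 * n by rewrite card_I; clear; lia.
  have n2 : 0 < 2 * n by move: n1; clear; lia.
  apply: leq_trans (for_time_le nm h Q1 n2) _.
  by clear; move: (S * S) => Q; lia.
have bt : elim_body_time I <= (expr_time (Get 5 (Var 7) == Const 1)%ram + ctime detach +
    ctime attach + ctime advance + 1 + ctime merge_init + (ctime merge_body + 40)) * (S * S).
  have h4 := f4 (ctime merge_body).
  rewrite /elim_body_time /merge_time /merge_loops_time -/S.
  move: h4 Q1; move: (ctime merge_body) (for_time S _) (S * S) (expr_time _).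
  move: (ctime detach) (ctime attach) (ctime advance) (ctime merge_init).
  by clear; move=> *; nia.
have {bt} := f5 _ _ bt.
rewrite /solver_time /setup_time /elim_time /finish_time /solver_const -/S -/n -/m.
have := f1 (ctime scan_edge); have := up (ctime init_scalars).
have := f3 (ctime init_index); have := f2 (ctime init_vertex).
have := up (ctime elim_init); have := up (ctime best_init).
have := f3 (ctime best_body); have := up (ctime select_root).
have := f1 (ctime back_body).
move: (ctime scan_edge) (ctime init_scalars) (ctime init_index) (ctime init_vertex).
move: (ctime elim_init) (ctime best_init) (ctime best_body) (ctime select_root).
move: (ctime back_body) (elim_body_time I) (2 * (_ + _)) (n * (S * S)).
by clear; move=> *; rewrite !mulnDl; lia.
Qed.

(** Half of the exponent 6 pays for the factor, as [20 <= 27 <= X ^ 3]; the other half bounds the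
    sum, which factors into a linear and a quadratic expression. *)
Lemma max_word_roomy (I : instance) : 0 < nV I -> roomy I (max_word 6 I).
Proof.
move=> n1; rewrite /roomy /max_word /tabsize.
set n := nV I in n1 *; set L := total_length I.
set X := n + L + 2.
have X3 : 27 <= X ^ 3 by rewrite -[27]/(3 ^ 3) leq_exp2r // /X; move: n1; clear; lia.
have -> : n * (L.+1 * L.+1) + n * n + 2 * n + L.+1 * L.+1 + 1 =
    (n + 1) * (L.+1 * L.+1 + n + 1) by clear; lia.
have h : (n + 1) * (L.+1 * L.+1 + n + 1) <= X * (X * X).
  by apply: leq_mul; rewrite /X; clear; nia.
rewrite (_ : 6 = 3 + 3) // expnD; apply: leq_mul.
  by apply: leq_trans X3.
by rewrite !expnS expn0 muln1.
Qed.

Theorem theorem4 :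
  exists (P : com) (k c : nat),
    forall I : instance, is_tree I ->
      exists (t : nat) (s : state),
        [/\ exec (max_word k I) P (input I) t s,
            t <= c * (nV I * (maxn 1 (total_length I)) ^ 4)
          & optimal (output I s)].
Proof.
exists solver, 6, (16 * solver_const) => I tree.
have [_ [n1 _] _] := tree.
have [t [s [he ht ho]]] := runs_solver tree (max_word_roomy n1).
exists t, s; split=> //; apply: leq_trans ht _.
exact: solver_time_le (tree_card tree).
Qed.
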